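(* Let $D$ be a bounded domain of $\mathbb{C}^n$ and let $V$ be a closed complex submanifold of $D$ biholomorphic to the unit disc $\Delta$. The following are equivalent: (i) $V$ is the image of a holomorphic retraction $\rho:D\to D$ (holomorphic with $\rho\circ\rho=\rho$); (ii) $V$ is the image of a complex geodesic $\varphi:\Delta\to D$; (iii) $c_D(x,y)=c_V(x,y)$ for all $x,y\in V$; (iv) there exist two distinct points $x,y\in V$ with $c_D(x,y)=c_V(x,y)$; (v) $E_D(x,v)=E_V(x,v)$ for all $x\in V$ and $v\in T_x(V)$; (vi) there exist $x\in V$ and $v\in T_x(V)$, $v\neq0$, with $E_D(x,v)=E_V(x,v)$.
   Context: $\Delta$ is the open unit disc of $\mathbb{C}$, $\omega(z,w)=\operatorname{artanh}\left|\frac{z-w}{1-\bar w z}\right|$ the Poincaré distance and $\alpha(z,v)=|v|/(1-|z|^2)$ the Poincaré metric. For a complex manifold $M$ (here $D$ or $V$) the Carathéodory pseudodistance is $c_M(z,w)=\sup\{\omega(g(z),g(w))\mid g:M\to\Delta\text{ holomorphic}\}$ and the Carathéodory (Reiffen) pseudometric is $E_M(z,v)=\sup\{\alpha(g(z),g'(z)v)\mid g:M\to\Delta\text{ holomorphic}\}$ for $v\in T_z(M)$. A complex geodesic of $D$ is a holomorphic $\varphi:\Delta\to D$ with $c_D(\varphi(\zeta),\varphi(\eta))=\omega(\zeta,\eta)$ for all $\zeta,\eta\in\Delta$. *)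

(* Defs.v *)
From mathcomp Require Import all_boot all_order all_algebra.
From mathcomp Require Import all_classical all_reals all_analysis.
From mathcomp Require Import complex.
Import Order.TTheory GRing.Theory Num.Theory.
Import numFieldNormedType.Exports.

Set Implicit Arguments.
Unset Strict Implicit.
Unset Printing Implicit Defensive.

Local Open Scope ring_scope.
Local Open Scope classical_set_scope.

(* The complex numbers C = R[i], as a numClosedFieldType (hence a normed
   module over itself); C^n is 'rV[Cx R]_n, a normed module over C. *)
Definition Cx (R : realType) : numClosedFieldType := R[i].

Definition cabs (R : realType) (z : Cx R) : R :=
  Num.sqrt (complex.Re z ^+ 2 + complex.Im z ^+ 2).

Definition unit_disc (R : realType) : set (Cx R) := [set z | cabs z < 1].
Arguments unit_disc R : clear implicits.

Definition artanh (R : realType) (t : R) : R := ln ((1 + t) / (1 - t)) / 2.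

Definition poincare_dist (R : realType) (z w : Cx R) : R :=
  artanh (cabs ((z - w) / (1 - Num.conj w * z))).

Definition poincare_metric (R : realType) (z v : Cx R) : R :=
  cabs v / (1 - cabs z ^+ 2).

(* holomorphic on an open set U: complex (C-linear Frechet) differentiable
   at every point of U *)
Definition holo_on (R : realType) (V W : normedModType (Cx R))
  (U : set V) (f : V -> W) : Prop :=
  forall z, U z -> differentiable f z.

Definition bounded_domain (R : realType) (n : nat) (D : set 'rV[Cx R]_n) : Prop :=
  D !=set0 /\ open D /\ connected D /\ bounded_set D.

Definition holo_to_disc (R : realType) (n : nat) (D : set 'rV[Cx R]_n)
  (g : 'rV[Cx R]_n -> Cx R) : Prop :=
  holo_on D g /\ (forall z, D z -> unit_disc R (g z)).

Definition cara_dist (R : realType) (n : nat) (D : set 'rV[Cx R]_n)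
  (x y : 'rV[Cx R]_n) : \bar R :=
  ereal_sup [set (poincare_dist (g x) (g y))%:E | g in holo_to_disc D].

Definition cara_metric (R : realType) (n : nat) (D : set 'rV[Cx R]_n)
  (x v : 'rV[Cx R]_n) : \bar R :=
  ereal_sup [set (poincare_metric (g x) ('D_v g x))%:E | g in holo_to_disc D].

(* V is a closed complex submanifold of D biholomorphic to Delta, with
   biholomorphism h : Delta -> V: h is a holomorphic injective immersion of
   Delta into D, a homeomorphism onto its image V, and V is closed in D. *)
Definition disc_submanifold (R : realType) (n : nat) (D V : set 'rV[Cx R]_n)
  (h : Cx R -> 'rV[Cx R]_n) : Prop :=
  holo_on (unit_disc R) h /\
  V = h @` unit_disc R /\
  V `<=` D /\
  (forall z, D z -> closure V z -> V z) /\
  {in unit_disc R &, injective h} /\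
  (forall z, unit_disc R z -> derive1 h z != 0) /\
  (forall U : set (Cx R), open U ->
     exists W : set 'rV[Cx R]_n, open W /\ h @` (U `&` unit_disc R) = W `&` V).

(* holomorphic maps V -> Delta, V carrying the complex structure given by
   the biholomorphism h : Delta -> V  (g : V -> C holomorphic iff g o h is) *)
Definition holo_sub_to_disc (R : realType) (n : nat) (V : set 'rV[Cx R]_n)
  (h : Cx R -> 'rV[Cx R]_n) (g : 'rV[Cx R]_n -> Cx R) : Prop :=
  holo_on (unit_disc R) (g \o h) /\ (forall z, V z -> unit_disc R (g z)).

Definition cara_dist_sub (R : realType) (n : nat) (V : set 'rV[Cx R]_n)
  (h : Cx R -> 'rV[Cx R]_n) (x y : 'rV[Cx R]_n) : \bar R :=
  ereal_sup [set (poincare_dist (g x) (g y))%:E | g in holo_sub_to_disc V h].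

Definition tangent_sub (R : realType) (n : nat) (h : Cx R -> 'rV[Cx R]_n)
  (x : 'rV[Cx R]_n) : set 'rV[Cx R]_n :=
  [set v | exists zeta lam, [/\ unit_disc R zeta, h zeta = x & v = lam *: derive1 h zeta]].

(* Caratheodory-Reiffen pseudometric of V: for v = lam h'(zeta) tangent at
   x = h(zeta), g'(x) v = lam (g o h)'(zeta). *)
Definition cara_metric_sub (R : realType) (n : nat) (V : set 'rV[Cx R]_n)
  (h : Cx R -> 'rV[Cx R]_n) (x v : 'rV[Cx R]_n) : \bar R :=
  ereal_sup [set r : \bar R | exists g zeta (lam : Cx R),
     [/\ holo_sub_to_disc V h g, unit_disc R zeta, h zeta = x,
         v = lam *: derive1 h zeta &
         r = (poincare_metric (g x) (lam * derive1 (g \o h) zeta))%:E]].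

Definition holo_retraction (R : realType) (n : nat) (D V : set 'rV[Cx R]_n)
  (rho : 'rV[Cx R]_n -> 'rV[Cx R]_n) : Prop :=
  [/\ holo_on D rho, (forall z, D z -> D (rho z)),
      (forall z, D z -> rho (rho z) = rho z) & rho @` D = V].

Definition complex_geodesic (R : realType) (n : nat) (D : set 'rV[Cx R]_n)
  (phi : Cx R -> 'rV[Cx R]_n) : Prop :=
  [/\ holo_on (unit_disc R) phi, (forall z, unit_disc R z -> D (phi z)) &
      (forall z w, unit_disc R z -> unit_disc R w ->
         cara_dist D (phi z) (phi w) = (poincare_dist z w)%:E)].

(* Main.v *)
Require Import Defs.
From HB Require Import structures.
From mathcomp Require Import all_boot all_order all_algebra.
From mathcomp Require Import all_classical all_reals all_analysis.
From mathcomp Require Import complex.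
From mathcomp Require Import ring lra.
Import Order.TTheory GRing.Theory Num.Theory.
Import numFieldNormedType.Exports.
Set Implicit Arguments.
Unset Strict Implicit.
Unset Printing Implicit Defensive.
Local Open Scope ring_scope.
Local Open Scope classical_set_scope.

(* Let h be the biholomorphism of the unit disc onto V.  Every condition is
   equivalent to the existence of a holomorphic G from D to the disc with
   G (h z) = z: then h \o G is a retraction and h is a geodesic.  The
   Schwarz-Pick lemma shows that c_V and E_V are, through h, the Poincare distance
   and metric.  If c_D or E_D agrees with them at one pair of points or one nonzero
   vector, extremal functions, normalized to vanish at the base point, have a
   pointwise limit along an ultrafilter; its composition with h attains equality in
   the Schwarz lemma, so it is a Moebius map, and undoing this map gives G.

   The Schwarz lemma is needed for functions that are only assumed complex
   differentiable.  In logarithmic coordinates Goursat's theorem on rectangles gives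
   the mean value property on circles, hence the maximum principle; replacing k by
   k^n (z - b) and letting n grow extends it to functions that are merely
   continuous at an exceptional point.  Applied to difference quotients this yields
   the Schwarz-Pick lemma with its equality case, and a second order Taylor estimate
   that makes bounded holomorphic functions closed under pointwise limits. *)

(** No contour integral is needed: a circulation around a rectangle involves only increments of
    antiderivatives along its sides, which the real mean value theorem controls. The mean value
    property then appears in a weak form: any two concentric circles carry points where the real
    parts agree. This suffices for the maximum principle.

    Exceptional points are forced by difference quotients: (f z - f b) / (z - b) is clearly
    continuous at b, but its differentiability there would require analyticity of f. So the equality
    cases use no power series: the Pick inequality, applied to the quotient itself, degenerates when
    a value has modulus 1 and makes the quotient constant.

    Along an ultrafilter every bounded sequence converges, so no subsequence is extracted, and the
    differentials converge together with the functions, as the infinitesimal conditions require. The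
    limit is a priori only bounded by 1; its zero at the base point and the connectedness of D bring
    it back into the open disc.

    From a retraction, G is obtained by composing with the inverse of h; its holomorphy rests on a
    nonzero coordinate of h' and on h being a homeomorphism onto V. *)

Section RealGoursat.
Variable R : realType.
Implicit Types (a b c d x y e : R).

Lemma MVT_closed (f df : R -> R) a b : a <= b ->
  (forall x, a <= x <= b -> is_derive x (1 : R) f (df x)) ->
  exists2 c, a <= c <= b & f b - f a = df c * (b - a).
Proof.
move=> ab fd; have [||c cab E] := @MVT_segment R f df a b ab.
- by move=> x; rewrite in_itv /= => /andP[/ltW ax /ltW xb]; apply: fd; rewrite ax.
- apply: derivable_within_continuous => x; rewrite in_itv /= => xab.
  by have [] := fd x xab.
by exists c.
Qed.

Lemma antiderivative_exists (f : R -> R) a b : a < b ->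
  (forall x, a <= x <= b -> {for x, continuous f}) ->
  exists F : R -> R, forall x, a < x < b -> is_derive x (1 : R) F (f x).
Proof.
move=> ab cf.
have fi : (@lebesgue_measure R).-integrable `[a, b] (EFin \o f).
  apply: continuous_compact_integrable; first exact: segment_compact.
  apply: continuous_in_subspaceT => x; rewrite inE /= in_itv /=; exact: cf.
exists (fun x => \int[lebesgue_measure]_(t in `[a, x]) f t)%R => x /andP[ax xb].
have [] := @continuous_FTC1_closed R f a x b xb fi ax.
  by apply: cf; rewrite !ltW.
by move=> dF <-; rewrite derive1E; exact: derivableP.
Qed.

(** * Goursat's theorem on rectangles *)

Section Rectangle.
Variables (A B P Q : R -> R -> R).

(* When A(., y) and B(x, .) are antiderivatives of P(., y) and Q(x, .), this is
   the integral of P dx + Q dy along the boundary of [a, b] x [c, d]. *)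
Definition rect_circ a b c d :=
  (A b c - A a c) - (A b d - A a d) + (B b d - B b c) - (B a d - B a c).

Definition rect_bounds := (R * R * (R * R))%type.

Definition circ_of (r : rect_bounds) :=
  rect_circ r.1.1 r.1.2 r.2.1 r.2.2.

Definition rect_quarter (s t : bool) (r : rect_bounds) : rect_bounds :=
  let m := (r.1.1 + r.1.2) / 2 in let k := (r.2.1 + r.2.2) / 2 in
  ((if s then m else r.1.1, if s then r.1.2 else m),
   (if t then k else r.2.1, if t then r.2.2 else k)).

Lemma circ_quarters r : circ_of r =
  circ_of (rect_quarter false false r) + circ_of (rect_quarter true false r) +
  (circ_of (rect_quarter false true r) + circ_of (rect_quarter true true r)).
Proof. by rewrite /circ_of /rect_circ /rect_quarter /=; ring. Qed.

Lemma big_quarter r : exists st : bool * bool,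
  `|circ_of r| <= 4 * `|circ_of (rect_quarter st.1 st.2 r)|.
Proof.
apply: contrapT => /forallNP H.
have H1 s t : 4 * `|circ_of (rect_quarter s t r)| < `|circ_of r|.
  by rewrite ltNge; apply/negP => h; apply: (H (s, t)).
have := circ_quarters r => /(congr1 (fun z : R => `|z|)) E.
have := H1 false false; have := H1 true false; have := H1 false true.
have := H1 true true; move: E.
set x := circ_of _; set y := circ_of _; set z := circ_of _.
set u := circ_of _; set v := circ_of _ => E.
have : `|y + z + (u + v)| <= `|y| + `|z| + (`|u| + `|v|).
  by apply: (le_trans (ler_normD _ _)); apply: lerD; apply: ler_normD.
by rewrite -E; lra.
Qed.

Definition next_rect r : rect_bounds :=
  let st := projT1 (cid (big_quarter r)) in rect_quarter st.1 st.2 r.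

Definition nth_rect r n := iter n next_rect r.

Lemma circ_nth_rect r n : `|circ_of r| <= 4 ^+ n * `|circ_of (nth_rect r n)|.
Proof.
elim: n => [|n IH]; first by rewrite expr0 mul1r.
apply: (le_trans IH); rewrite exprSr -mulrA ler_pM2l ?exprn_gt0 //.
by rewrite /nth_rect iterS {2}/next_rect; case: cid.
Qed.

Definition wf_rect (r : rect_bounds) := (r.1.1 <= r.1.2) && (r.2.1 <= r.2.2).

Definition sub_rect (r s : rect_bounds) :=
  [&& s.1.1 <= r.1.1, r.1.2 <= s.1.2, s.2.1 <= r.2.1 & r.2.2 <= s.2.2].

Lemma next_rectP r : wf_rect r ->
  [/\ wf_rect (next_rect r), sub_rect (next_rect r) r,
   (next_rect r).1.2 - (next_rect r).1.1 = (r.1.2 - r.1.1) / 2 &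
   (next_rect r).2.2 - (next_rect r).2.1 = (r.2.2 - r.2.1) / 2].
Proof.
rewrite /wf_rect /sub_rect /next_rect; case: cid => -[s t] _ /= /andP[h1 h2].
case: s; case: t; rewrite /rect_quarter /=; split; try lra;
  by repeat (apply/andP; split); lra.
Qed.

Lemma nth_rectP r n : wf_rect r ->
  [/\ wf_rect (nth_rect r n),
   (nth_rect r n).1.2 - (nth_rect r n).1.1 = (r.1.2 - r.1.1) / 2 ^+ n &
   (nth_rect r n).2.2 - (nth_rect r n).2.1 = (r.2.2 - r.2.1) / 2 ^+ n].
Proof.
move=> wf; elim: n => [|n [IH1 IH2 IH3]]; first by rewrite expr0 !divr1.
have [h1 _ h3 h4] := next_rectP IH1.
rewrite /nth_rect iterS -/(nth_rect r n); split => //.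
- by rewrite h3 IH2 exprSr invfM mulrA.
- by rewrite h4 IH3 exprSr invfM mulrA.
Qed.

Lemma nth_rect_sub r n m : wf_rect r -> sub_rect (nth_rect r (m + n)) (nth_rect r n).
Proof.
move=> wf; elim: m => [|m IH]; first by rewrite add0n /sub_rect !lexx.
have [wm _ _] := nth_rectP (m + n) wf.
have [_ h2 _ _] := next_rectP wm.
rewrite addSn [nth_rect _ (_ + _).+1]iterS -/(nth_rect r (m + n)).
move: IH h2; rewrite /sub_rect => /and4P[? ? ? ?] /and4P[? ? ? ?].
by repeat (apply/andP; split); lra.
Qed.

Lemma nested_point (u v : nat -> R) : (forall n m, u n <= v m) ->
  exists x, forall n, u n <= x <= v n.
Proof.
move=> uv; exists (sup (range u)) => n; apply/andP; split.
  by apply: ub_le_sup; [exists (v n) => _ [m _ <-] | exists n].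
by apply: ge_sup; [exists (u 0%N); exists 0%N | move=> _ [m _ <-]].
Qed.

Lemma rect_point r : wf_rect r -> exists x y, forall n,
  ((nth_rect r n).1.1 <= x <= (nth_rect r n).1.2) /\
  ((nth_rect r n).2.1 <= y <= (nth_rect r n).2.2).
Proof.
move=> wf.
have cmp n m : ((nth_rect r n).1.1 <= (nth_rect r m).1.2) /\
    ((nth_rect r n).2.1 <= (nth_rect r m).2.2).
  have /and4P[a1 a2 a3 a4] := nth_rect_sub n m wf.
  have /and4P[b1 b2 b3 b4] := nth_rect_sub m n wf.
  have [/andP[c1 c2] _ _] := nth_rectP (m + n) wf.
  move: b1 b2 b3 b4; rewrite (addnC n m) => b1 b2 b3 b4; split; lra.
have [x Hx] := nested_point (fun n m => (cmp n m).1).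
have [y Hy] := nested_point (fun n m => (cmp n m).2).
by exists x, y.
Qed.

(** The mean value theorem, applied to the difference of the two horizontal sides and to that of the
    two vertical sides, leaves an increment of [P] in y and one of [Q] in x. Their linear parts
    share the slope [p2], which expresses closedness of the form at the point, so they cancel and
    only the error terms remain. *)
Lemma circ_small a b c d x y p1 p2 q2 e : a <= x <= b -> c <= y <= d -> 0 <= e ->
  (forall x' y', a <= x' <= b -> c <= y' <= d ->
     is_derive x' (1 : R) (fun t => A t y') (P x' y') /\
     is_derive y' (1 : R) (B x') (Q x' y')) ->
  (forall x' y', a <= x' <= b -> c <= y' <= d ->
   `|P x' y' - P x y - p1 * (x' - x) - p2 * (y' - y)| <= e * (`|x' - x| + `|y' - y|) /\
   `|Q x' y' - Q x y - p2 * (x' - x) - q2 * (y' - y)| <= e * (`|x' - x| + `|y' - y|)) ->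
  `|rect_circ a b c d| <= 2 * e * ((b - a) + (d - c)) ^+ 2.
Proof.
move=> /andP[ax xb] /andP[cy yd] e0 dAB est.
have ab := le_trans ax xb; have cd := le_trans cy yd.
have [xi xiI E1] : exists2 xi, a <= xi <= b &
    (A b c - A b d) - (A a c - A a d) = (P xi c - P xi d) * (b - a).
  apply: (@MVT_closed (fun t => A t c - A t d) (fun t => P t c - P t d)) => // t tI.
  have [d1 _] := dAB t c tI ltac:(by rewrite lexx cd).
  have [d2 _] := dAB t d tI ltac:(by rewrite lexx cd).
  exact: is_deriveB.
have [eta etaI E2] : exists2 eta, c <= eta <= d &
    (B b d - B a d) - (B b c - B a c) = (Q b eta - Q a eta) * (d - c).
  apply: (@MVT_closed (fun t => B b t - B a t) (fun t => Q b t - Q a t)) => // t tI.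
  have [_ d1] := dAB b t ltac:(by rewrite lexx ab) tI.
  have [_ d2] := dAB a t ltac:(by rewrite lexx ab) tI.
  exact: is_deriveB.
have bnd x' y' : a <= x' <= b -> c <= y' <= d ->
    e * (`|x' - x| + `|y' - y|) <= e * ((b - a) + (d - c)).
  move=> /andP[? ?] /andP[? ?]; apply: ler_wpM2l => //.
  by apply: lerD; rewrite ler_norml; apply/andP; split; lra.
have cI : c <= c <= d by rewrite lexx.
have dI : c <= d <= d by rewrite lexx cd.
have aI : a <= a <= b by rewrite lexx.
have bI : a <= b <= b by rewrite lexx ab.
have F1 := le_trans (est xi c xiI cI).1 (bnd _ _ xiI cI).
have F2 := le_trans (est xi d xiI dI).1 (bnd _ _ xiI dI).
have F3 := le_trans (est b eta bI etaI).2 (bnd _ _ bI etaI).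
have F4 := le_trans (est a eta aI etaI).2 (bnd _ _ aI etaI).
have -> : rect_circ a b c d =
   (P xi c - P xi d + p2 * (d - c)) * (b - a) + (Q b eta - Q a eta - p2 * (b - a)) * (d - c).
  have -> : rect_circ a b c d = ((A b c - A b d) - (A a c - A a d)) +
     ((B b d - B a d) - (B b c - B a c)) by rewrite /rect_circ; ring.
  by rewrite E1 E2; ring.
set s := (b - a) + (d - c) in F1 F2 F3 F4 bnd *.
have G1 : `|P xi c - P xi d + p2 * (d - c)| <= 2 * e * s.
  by move: F1 F2; rewrite !ler_norml => /andP[? ?] /andP[? ?]; apply/andP; split; lra.
have G2 : `|Q b eta - Q a eta - p2 * (b - a)| <= 2 * e * s.
  by move: F3 F4; rewrite !ler_norml => /andP[? ?] /andP[? ?]; apply/andP; split; lra.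
apply: (le_trans (ler_normD _ _)); rewrite !normrM.
rewrite (ger0_norm (_ : 0 <= b - a)) ?subr_ge0 // (ger0_norm (_ : 0 <= d - c)) ?subr_ge0 //.
have -> : 2 * e * s ^+ 2 = 2 * e * s * (b - a) + 2 * e * s * (d - c) by rewrite /s; ring.
by apply: lerD; apply: ler_wpM2r; rewrite ?subr_ge0.
Qed.

Theorem goursat_rectangle a b c d : a <= b -> c <= d ->
  (forall x y, a <= x <= b -> c <= y <= d ->
     is_derive x (1 : R) (fun t => A t y) (P x y) /\
     is_derive y (1 : R) (B x) (Q x y)) ->
  (forall x y, a <= x <= b -> c <= y <= d -> exists p1 p2 q2, forall e, 0 < e ->
     exists2 dl, 0 < dl & forall x' y', `|x' - x| < dl -> `|y' - y| < dl ->
   `|P x' y' - P x y - p1 * (x' - x) - p2 * (y' - y)| <= e * (`|x' - x| + `|y' - y|) /\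
   `|Q x' y' - Q x y - p2 * (x' - x) - q2 * (y' - y)| <= e * (`|x' - x| + `|y' - y|)) ->
  rect_circ a b c d = 0.
Proof.
move=> ab cd dAB est; apply/eqP; rewrite -normr_eq0 eq_le normr_ge0 andbT leNgt.
apply/negP => J0; set r : rect_bounds := ((a, b), (c, d)).
have wf : wf_rect r by rewrite /wf_rect /= ab cd.
have [x [y Hxy]] := rect_point wf.
have [/= xI yI] := Hxy 0%N.
have [p1 [p2 [q2 H]]] := est x y xI yI.
pose w := (b - a) + (d - c); have w0 : 0 <= w by rewrite /w; lra.
(* At level n, [circ_small] gives 2 e (w / 2^n)^2, and the factor 4^n of [circ_nth_rect] cancels the
   4^-n. The resulting 2 e w^2 is at most half of the circulation for this choice of e; the added 1
   covers w = 0. *)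
have := H (`|rect_circ a b c d| / (4 * (w ^+ 2 + 1))) _.
case; first by apply: divr_gt0 => //; nra.
move=> dl dl0 Hdl.
have [n Hn] : exists n, w / 2 ^+ n < dl.
  have : (w / 2 ^+ n @[n --> \oo]) --> (w * 0 : R).
    apply: cvgMr; under eq_fun do rewrite -exprVn.
    by apply: cvg_expr; rewrite ger0_norm; lra.
  rewrite mulr0 => /cvgrPdist_lt /(_ _ dl0) [N _ /(_ N (leqnn _))] /=.
  rewrite sub0r normrN ger0_norm; first by exists N.
  by rewrite mulr_ge0 // invr_ge0 exprn_ge0.
have [/andP[wf1 wf2] W1 W2] := nth_rectP n wf.
have [xIn yIn] := Hxy n.
have sub : sub_rect (nth_rect r n) r by have := nth_rect_sub 0 n wf; rewrite addn0.
have /and4P[/= s1 s2 s3 s4] := sub.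
have C1 := circ_nth_rect r n.
have S : (nth_rect r n).1.2 - (nth_rect r n).1.1 +
    ((nth_rect r n).2.2 - (nth_rect r n).2.1) = w / 2 ^+ n.
  by rewrite W1 W2 /= -mulrDl.
have C2 : `|circ_of (nth_rect r n)| <=
    2 * (`|rect_circ a b c d| / (4 * (w ^+ 2 + 1))) * (w / 2 ^+ n) ^+ 2.
  rewrite -S; apply: (@circ_small _ _ _ _ x y p1 p2 q2 _ xIn yIn).
  - by apply: divr_ge0 => //; nra.
  - by move=> x' y' /andP[? ?] /andP[? ?]; apply: dAB; apply/andP; split; lra.
  - move=> x' y' /andP[? ?] /andP[? ?]; apply: Hdl;
    by move: xIn yIn => /andP[? ?] /andP[? ?]; rewrite ltr_norml; apply/andP; split; lra.
have := le_trans C1 (ler_wpM2l (exprn_ge0 n (ltac:(lra) : 0 <= 4 :> R)) C2).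
have -> : circ_of r = rect_circ a b c d by [].
have -> (t : R) : 4 ^+ n * (2 * t * (w / 2 ^+ n) ^+ 2) = 2 * t * w ^+ 2.
  have -> : (4 : R) ^+ n = 2 ^+ n * 2 ^+ n by rewrite -exprMn -natrM.
  by field; rewrite expf_neq0.
set j := `|_| in J0 *; apply/negP; rewrite -ltNge.
have -> : 2 * (j / (4 * (w ^+ 2 + 1))) * w ^+ 2 = (j / 2) * (w ^+ 2 / (w ^+ 2 + 1)).
  by field; nra.
have : w ^+ 2 / (w ^+ 2 + 1) <= 1 by rewrite ler_pdivrMr ?mul1r; nra.
set t := _ / _; nra.
Qed.

End Rectangle.
End RealGoursat.

(** * The real-valued modulus and the real coordinates of complex numbers *)

Section ComplexModulus.
Variable R : realType.
Local Notation C := (Cx R).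
Implicit Types (z w : C) (x y e : R).

Definition toC (x : R) : C := real_complex R x.

Lemma cabsE z : `|z| = toC (cabs z).
Proof. exact: normc_def. Qed.

Lemma toC_inj : injective toC.
Proof. exact: complexI. Qed.

Lemma toC0 : toC 0 = 0. Proof. by []. Qed.

Lemma toC1 : toC 1 = 1. Proof. by []. Qed.

Lemma toCD x y : toC (x + y) = toC x + toC y.
Proof. exact: (rmorphD (real_complex R)). Qed.

Lemma toCN x : toC (- x) = - toC x.
Proof. exact: (rmorphN (real_complex R)). Qed.

Lemma toCM x y : toC (x * y) = toC x * toC y.
Proof. exact: (rmorphM (real_complex R)). Qed.

Lemma toCV x : toC x^-1 = (toC x)^-1.
Proof. exact: (fmorphV (real_complex R)). Qed.

Lemma toCX x n : toC (x ^+ n) = toC x ^+ n.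
Proof. exact: (rmorphXn (real_complex R)). Qed.

Lemma toC_le x y : (toC x <= toC y) = (x <= y).
Proof. exact: lecR. Qed.

Lemma toC_lt x y : (toC x < toC y) = (x < y).
Proof. exact: ltcR. Qed.

Lemma ReToC x : complex.Re (toC x) = x. Proof. by []. Qed.

Lemma ImToC x : complex.Im (toC x) = 0. Proof. by []. Qed.

Lemma cabs0 : cabs (0 : C) = 0.
Proof. by apply: toC_inj; rewrite -cabsE normr0. Qed.

Lemma cabs1 : cabs (1 : C) = 1.
Proof. by apply: toC_inj; rewrite -cabsE normr1. Qed.

Lemma cabs_ge0 z : 0 <= cabs z.
Proof. exact: sqrtr_ge0. Qed.

Lemma cabs_eq0 z : (cabs z == 0) = (z == 0).
Proof. by rewrite -[RHS]normr_eq0 cabsE -(inj_eq toC_inj). Qed.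

Lemma cabs_gt0 z : (0 < cabs z) = (z != 0).
Proof. by rewrite lt_def cabs_ge0 andbT cabs_eq0. Qed.

Lemma cabsM z w : cabs (z * w) = cabs z * cabs w.
Proof. by apply: toC_inj; rewrite toCM -!cabsE normrM. Qed.

Lemma cabsN z : cabs (- z) = cabs z.
Proof. by apply: toC_inj; rewrite -!cabsE normrN. Qed.

Lemma cabsBC z w : cabs (z - w) = cabs (w - z).
Proof. by rewrite -cabsN opprB. Qed.

Lemma cabsV z : cabs z^-1 = (cabs z)^-1.
Proof. by apply: toC_inj; rewrite toCV -!cabsE normfV. Qed.

Lemma cabsX z n : cabs (z ^+ n) = cabs z ^+ n.
Proof. by apply: toC_inj; rewrite toCX -!cabsE normrX. Qed.

Lemma cabsD z w : cabs (z + w) <= cabs z + cabs w.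
Proof. by rewrite -toC_le toCD -!cabsE ler_normD. Qed.

Lemma cabsB z w : cabs (z - w) <= cabs z + cabs w.
Proof. by rewrite -(cabsN w) cabsD. Qed.

Lemma cabs_distD z w : cabs z - cabs w <= cabs (z - w).
Proof. by rewrite lerBlDr -{1}(subrK w z) cabsD. Qed.

Lemma cabs_real x : cabs (toC x) = `|x|.
Proof. by rewrite /cabs /= expr0n addr0 sqrtr_sqr. Qed.

Lemma cabs_conj z : cabs (Num.conj z) = cabs z.
Proof. by apply: toC_inj; rewrite -!cabsE norm_conjC. Qed.

Lemma sqr_cabs z : cabs z ^+ 2 = complex.Re z ^+ 2 + complex.Im z ^+ 2.
Proof. by rewrite sqr_sqrtr // addr_ge0 // sqr_ge0. Qed.

Lemma ReD z w : complex.Re (z + w) = complex.Re z + complex.Re w.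
Proof. by case: z => a b; case: w => c d. Qed.

Lemma ReN z : complex.Re (- z) = - complex.Re z.
Proof. by case: z. Qed.

Lemma ReB z w : complex.Re (z - w) = complex.Re z - complex.Re w.
Proof. by rewrite ReD ReN. Qed.

Lemma ImD z w : complex.Im (z + w) = complex.Im z + complex.Im w.
Proof. by case: z => a b; case: w => c d. Qed.

Lemma ImN z : complex.Im (- z) = - complex.Im z.
Proof. by case: z. Qed.

Lemma ImB z w : complex.Im (z - w) = complex.Im z - complex.Im w.
Proof. by rewrite ImD ImN. Qed.

Lemma ReM z w : complex.Re (z * w) =
  complex.Re z * complex.Re w - complex.Im z * complex.Im w.
Proof. by case: z => a b; case: w => c d. Qed.

Lemma ImM z w : complex.Im (z * w) =
  complex.Re z * complex.Im w + complex.Im z * complex.Re w.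
Proof. by case: z => a b; case: w => c d. Qed.

Lemma Re_conj z : complex.Re (Num.conj z) = complex.Re z.
Proof. by case: z. Qed.

Lemma Im_conj z : complex.Im (Num.conj z) = - complex.Im z.
Proof. by case: z. Qed.

Lemma complex_ext z w : complex.Re z = complex.Re w -> complex.Im z = complex.Im w -> z = w.
Proof. by case: z => a b; case: w => c d /= -> ->. Qed.

Lemma Re_le_cabs z : `|complex.Re z| <= cabs z.
Proof.
by rewrite -sqrtr_sqr ler_sqrt ?addr_ge0 ?sqr_ge0 // lerDl sqr_ge0.
Qed.

Lemma Im_le_cabs z : `|complex.Im z| <= cabs z.
Proof.
by rewrite -sqrtr_sqr ler_sqrt ?addr_ge0 ?sqr_ge0 // lerDr sqr_ge0.
Qed.

Lemma cabs_le_ReIm z : cabs z <= `|complex.Re z| + `|complex.Im z|.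
Proof.
rewrite -(@ler_pXn2r _ 2) ?nnegrE ?cabs_ge0 ?addr_ge0 // sqr_cabs.
rewrite sqrrD !real_normK ?num_real // addrAC lerDl.
by rewrite mulrn_wge0 // mulr_ge0.
Qed.

Lemma mul_conj z : z * Num.conj z = toC (cabs z ^+ 2).
Proof. by rewrite toCX -cabsE normCK. Qed.

End ComplexModulus.

(** * Real-valued norms and epsilon-delta forms of differentiability *)

Section RealNorm.
Variable R : realType.
Local Notation C := (Cx R).

(** Norms over [Cx R] take values in [Cx R]; being nonnegative, they are determined by their real
    part, so estimates can be carried out in [R]. *)
Definition rnorm (V : normedModType C) (v : V) : R := complex.Re `|v|.

Lemma rnormE (V : normedModType C) (v : V) : `|v| = toC (rnorm v).
Proof. by rewrite /rnorm /toC; apply/esym/RRe_real/ger0_real. Qed.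

Lemma rnorm_cabs (z : C) : rnorm z = cabs z.
Proof. by apply: (@toC_inj R); rewrite -rnormE cabsE. Qed.

Section Norm.
Variable V : normedModType C.
Implicit Types (u v : V) (c : C).

Lemma rnorm_ge0 v : 0 <= rnorm v.
Proof. by rewrite -toC_le toC0 -rnormE normr_ge0. Qed.

Lemma rnorm0 : rnorm (0 : V) = 0.
Proof. by apply: (@toC_inj R); rewrite -rnormE normr0. Qed.

Lemma rnorm_eq0 v : (rnorm v == 0) = (v == 0).
Proof. by rewrite -[RHS]normr_eq0 rnormE -(inj_eq (@toC_inj R)). Qed.

Lemma rnormN v : rnorm (- v) = rnorm v.
Proof. by apply: (@toC_inj R); rewrite -!rnormE normrN. Qed.

Lemma rnormZ c v : rnorm (c *: v) = cabs c * rnorm v.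
Proof. by apply: (@toC_inj R); rewrite toCM -!rnormE -cabsE normrZ. Qed.

Lemma gt0_realP (e : C) : 0 < e -> exists2 r : R, 0 < r & e = (toC r).
Proof.
case: e => a b; rewrite ltcE /= => /andP[/eqP -> a0]; by exists a.
Qed.

Lemma near_rnormP (x : V) (P : set V) :
  (\forall y \near x, P y) <->
  exists2 d : R, 0 < d & forall y, rnorm (y - x) < d -> P y.
Proof.
rewrite nbhs_normP; split => [[e e0 H]|[d d0 H]].
  have [r r0 E] := gt0_realP e0; exists r => // y Hy; apply: H => /=.
  by rewrite E rnormE toC_lt -rnormN opprB.
exists (toC d); first by rewrite /= toC_lt.
by move=> y /=; rewrite rnormE toC_lt => Hy; apply: H; rewrite -rnormN opprB.
Qed.

End Norm.

Section Differentiable.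
Variables V W : normedModType C.

Definition linear_approx (f : V -> W) (x : V) (L : V -> W) : Prop :=
  forall e : R, 0 < e -> exists2 d : R, 0 < d &
    forall t, rnorm t < d -> rnorm (f (t + x) - f x - L t) <= e * rnorm t.

Lemma linear_approxP (f : V -> W) x (L : V -> W) : linear_approx f x L <->
  f \o shift x = cst (f x) + L +o_ 0 id.
Proof.
split => [H|/eqaddoP H].
  apply/eqaddoP => eps eps0; have [r r0 ->] := gt0_realP eps0.
  apply/near_rnormP; have [d d0 Hd] := H r r0; exists d => // t.
  rewrite subr0 => /Hd; rewrite -toC_le toCM -!rnormE => Ht.
  by rewrite /= !fctE opprD addrA.
move=> e e0; have /H : 0 < (toC e) :> C by rewrite toC_lt.
move=> /near_rnormP [d d0 Hd]; exists d => // t Ht.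
have := Hd t; rewrite subr0 => /(_ Ht).
by rewrite !fctE /= opprD addrA !rnormE -toCM toC_le.
Qed.

Lemma differentiable_approx (f : V -> W) x : differentiable f x ->
  linear_approx f x ('d f x).
Proof. by move=> /diff_locally H; apply/linear_approxP. Qed.

Lemma approx_differentiable (f : V -> W) x (L : V -> W) (M : R) : linear L ->
  (forall t, rnorm (L t) <= M * rnorm t) -> linear_approx f x L ->
  differentiable f x /\ 'd f x = L :> (V -> W).
Proof.
move=> lin LM /linear_approxP H.
pose Lm := GRing.isLinear.Build C V W *:%R L lin.
pose Lf : {linear V -> W} := HB.pack L Lm.
(* [diff_unique] asks for a continuous linear candidate; the bound [M] provides the continuity. *)
have cL : continuous Lf.
  apply/linear_bounded_continuous/linear_boundedP.
  exists (toC M); split; first by rewrite realE toC_le toC_le le_total.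
  move=> y My t; rewrite rnormE.
  apply: (@le_trans _ _ ((toC M) * `|t|)); first by rewrite rnormE -toCM toC_le.
  by apply: ler_wpM2r => //; exact: ltW.
have E := @diff_unique _ _ _ f Lf x cL H.
by split => //; apply/diff_locallyP; rewrite E.
Qed.

Lemma diff_bounded (f : V -> W) x : differentiable f x ->
  exists2 M : R, 0 < M & forall t, rnorm ('d f x t) <= M * rnorm t.
Proof.
move=> df; have /linear_bounded_continuous/linear_boundedP := diff_continuous df.
case=> M [Mr H].
have {}Mr : M = toC (complex.Re M) by rewrite /toC; apply/esym/RRe_real.
exists (Num.max (complex.Re M + 1) 1); first by rewrite lt_max ltr01 orbT.
move=> t; rewrite -toC_le toCM -!rnormE; apply: H.
by rewrite Mr toC_lt lt_max ltrDl ltr01.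
Qed.

Lemma continuous_rnorm (f : V -> W) x : {for x, continuous f} ->
  forall e : R, 0 < e -> exists2 d : R, 0 < d &
    forall y, rnorm (y - x) < d -> rnorm (f y - f x) < e.
Proof.
move=> /cvgrPdist_lt H e e0; have /H : 0 < (toC e) :> C by rewrite toC_lt.
move=> /near_rnormP [d d0 Hd]; exists d => // y /Hd.
by rewrite rnormE toC_lt -rnormN opprB.
Qed.

Lemma rnorm_continuous (f : V -> W) x :
  (forall e : R, 0 < e -> exists2 d : R, 0 < d &
    forall y, rnorm (y - x) < d -> rnorm (f y - f x) < e) ->
  {for x, continuous f}.
Proof.
move=> H; apply/cvgrPdist_lt => e e0; have [r r0 ->] := gt0_realP e0.
apply/near_rnormP; have [d d0 Hd] := H r r0; exists d => // y /Hd.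
by rewrite rnormE toC_lt -rnormN opprB.
Qed.

End Differentiable.

Definition cder (f : C -> C) (z c : C) : Prop :=
  forall e : R, 0 < e -> exists2 d : R, 0 < d &
    forall w, cabs (w - z) < d -> cabs (f w - f z - c * (w - z)) <= e * cabs (w - z).

Definition ccont (f : C -> C) (z : C) : Prop :=
  forall e : R, 0 < e -> exists2 d : R, 0 < d &
    forall w, cabs (w - z) < d -> cabs (f w - f z) < e.

Lemma cder_differentiable (f : C -> C) z c : cder f z c ->
  differentiable f z /\ derive1 f z = c.
Proof.
move=> H.
have [] := @approx_differentiable _ _ f z (fun t => t * c) (cabs c).
- by move=> a u v; rewrite mulrDl scalerAl.
- by move=> t; rewrite !rnorm_cabs /= cabsM mulrC.
- move=> e e0; have [d d0 Hd] := H e e0; exists d => // t.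
  rewrite !rnorm_cabs => Ht; have := Hd (t + z); rewrite addrK => /(_ Ht).
  by rewrite mulrC.
by move=> df E; split => //; rewrite derive1E deriveE // E /= mul1r.
Qed.

Lemma differentiable_cder (f : C -> C) z : differentiable f z ->
  cder f z (derive1 f z).
Proof.
move=> df e e0; have [d d0 H] := differentiable_approx df e0.
exists d => // w Hw; have := H (w - z); rewrite !rnorm_cabs => /(_ Hw).
by rewrite subrK (diff1E df) /= [_ *: _]mulrC.
Qed.

Lemma differentiable_ccont (f : C -> C) z : differentiable f z -> ccont f z.
Proof.
move=> /differentiable_continuous/continuous_rnorm H e /H [d d0 Hd].
by exists d => // w; rewrite -!rnorm_cabs; apply: Hd.
Qed.

End RealNorm.

(** * Logarithmic coordinates on the punctured plane *)

Section LogCoordinates.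
Variable R : realType.
Local Notation C := (Cx R).
Implicit Types (s t e : R).

Lemma is_derive_approx (f : R -> R) s df : is_derive s (1 : R) f df ->
  forall e, 0 < e -> exists2 d : R, 0 < d &
    forall s', `|s' - s| < d -> `|f s' - f s - df * (s' - s)| <= e * `|s' - s|.
Proof.
move=> [fd <-] e e0; move/derivable_nbhs: fd => /eqaddoP /(_ e e0).
move=> /nbhs_normP [d d0 H]; exists d => // s' Hs'.
have := H (s' - s); rewrite /= sub0r normrN => /(_ Hs').
rewrite !fctE /= opprD addrA [_ *: 1]mulr1 subrK.
by rewrite [(s' - s) *: _]mulrC.
Qed.

(** Joint differentiability in (s, t), wanted for the coordinates of [logpt], which are products of
    a function of s and a function of t. *)
Lemma prod_approx (f g : R -> R) s t df dg :
  is_derive s (1 : R) f df -> is_derive t (1 : R) g dg ->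
  forall e, 0 < e -> exists2 d : R, 0 < d &
    forall s' t', `|s' - s| < d -> `|t' - t| < d ->
    `|f s' * g t' - f s * g t - df * g t * (s' - s) - f s * dg * (t' - t)| <=
      e * (`|s' - s| + `|t' - t|).
Proof.
move=> fd gd e e0.
pose M : R := 1 + `|f s| + `|df| + `|g t| + `|dg|.
have M1 : 1 <= M.
  by rewrite /M; move: (normr_ge0 (f s)) (normr_ge0 df) (normr_ge0 (g t)) (normr_ge0 dg); lra.
pose e1 := Num.min 1 (e / (4 * M)).
have eM : 0 < e / (4 * M) by apply: divr_gt0 => //; lra.
have e10 : 0 < e1 by rewrite lt_min ltr01 eM.
have e11 : e1 <= 1 by rewrite ge_min lexx.
have e1M : 4 * M * e1 <= e.
  rewrite mulrC -ler_pdivlMr; last lra.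
  by rewrite ge_min lexx orbT.
have [d1 d10 H1] := is_derive_approx fd e10.
have [d2 d20 H2] := is_derive_approx gd e10.
exists (Num.min (Num.min d1 d2) (e1 / (2 * M))).
  rewrite !lt_min d10 d20 /=; apply: divr_gt0 => //; lra.
move=> s' t'; rewrite !lt_min => /andP[/andP[sd1 sd2] sd3] /andP[/andP[td1 td2] td3].
have {H1} H1 := H1 _ sd1; have {H2} H2 := H2 _ td2.
have F : `|f s' - f s| <= e1.
  have -> : f s' - f s = (f s' - f s - df * (s' - s)) + df * (s' - s) by ring.
  apply: (le_trans (ler_normD _ _)); rewrite normrM.
  move: sd3; rewrite ltr_pdivlMr; last lra.
  have : `|df| + 1 <= M.
    by rewrite /M; move: (normr_ge0 (f s)) (normr_ge0 df) (normr_ge0 (g t)) (normr_ge0 dg); lra.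
  move: H1 (normr_ge0 (s' - s)) (normr_ge0 df); nra.
have FM : `|f s'| <= M.
  have -> : f s' = (f s' - f s) + f s by ring.
  apply: (le_trans (ler_normD _ _)).
  by move: F; rewrite /M; move: (normr_ge0 (f s)) (normr_ge0 df) (normr_ge0 (g t)) (normr_ge0 dg); lra.
have -> : f s' * g t' - f s * g t - df * g t * (s' - s) - f s * dg * (t' - t) =
  f s' * (g t' - g t - dg * (t' - t)) + (f s' - f s - df * (s' - s)) * g t +
  (f s' - f s) * dg * (t' - t) by ring.
have gM : `|g t| <= M.
  by rewrite /M; move: (normr_ge0 (f s)) (normr_ge0 df) (normr_ge0 (g t)) (normr_ge0 dg); lra.
have dgM : `|dg| <= M.
  by rewrite /M; move: (normr_ge0 (f s)) (normr_ge0 df) (normr_ge0 (g t)) (normr_ge0 dg); lra.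
apply: (le_trans (ler_normD _ _)); apply: (le_trans (lerD (ler_normD _ _) (lexx _))).
rewrite !normrM.
have B1 : `|f s'| * `|g t' - g t - dg * (t' - t)| <= M * (e1 * `|t' - t|).
  exact: ler_pM.
have B2 : `|f s' - f s - df * (s' - s)| * `|g t| <= e1 * `|s' - s| * M.
  exact: ler_pM.
have B3 : `|f s' - f s| * `|dg| * `|t' - t| <= e1 * M * `|t' - t|.
  by apply: ler_wpM2r => //; apply: ler_pM.
have X0 := normr_ge0 (s' - s); have Y0 := normr_ge0 (t' - t).
apply: (le_trans (lerD (lerD B1 B2) B3)).
apply: (@le_trans _ _ (4 * M * e1 * (`|s' - s| + `|t' - t|))); last first.
  by apply: ler_wpM2r => //; lra.
have Me : 0 <= M * e1 by apply: mulr_ge0; lra.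
by move: (mulr_ge0 Me X0) (mulr_ge0 Me Y0); lra.
Qed.

(** This is e^(s + i t): vertical segments of length 2 pi become circles about 0, and the half-plane
    s < 0 covers the punctured unit disc. *)
Definition logpt s t : C := Complex (expR s * cos t) (expR s * sin t).

Lemma cabs_logpt s t : cabs (logpt s t) = expR s.
Proof.
rewrite /cabs /= !exprMn -mulrDr cos2Dsin2 mulr1 sqrtr_sqr ger0_norm //.
Qed.

Lemma logpt_approx s t e : 0 < e -> exists2 d : R, 0 < d &
  forall s' t', `|s' - s| < d -> `|t' - t| < d ->
  cabs (logpt s' t' - logpt s t - logpt s t * Complex (s' - s) (t' - t)) <=
    e * (`|s' - s| + `|t' - t|).
Proof.
move=> e0; have e20 : 0 < e / 2 by lra.
have [d1 d10 H1] := prod_approx (is_derive_expR s) (is_derive_cos t) e20.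
have [d2 d20 H2] := prod_approx (is_derive_expR s) (is_derive_sin t) e20.
exists (Num.min d1 d2); first by rewrite lt_min d10 d20.
move=> s' t'; rewrite !lt_min => /andP[s1 s2] /andP[t1 t2].
apply: (le_trans (cabs_le_ReIm _)).
have := lerD (H1 _ _ s1 t1) (H2 _ _ s2 t2).
rewrite -mulrDl -splitr; apply: le_trans; apply: lerD.
  by rewrite !ReB ReM /= le_eqVlt; apply/orP; left; apply/eqP; congr `|_|; ring.
by rewrite !ImB ImM /= le_eqVlt; apply/orP; left; apply/eqP; congr `|_|; ring.
Qed.

Section Comp.
Variable k : C -> C.

(** The real differential in (s, t) is multiplication by a single complex number. This is the
    Cauchy-Riemann relation, and it supplies the common slope [p2] required by
    [goursat_rectangle]. *)
Lemma comp_logpt_approx s t : differentiable k (logpt s t) ->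
  exists c : C, forall e, 0 < e -> exists2 d : R, 0 < d &
  forall s' t', `|s' - s| < d -> `|t' - t| < d ->
  cabs (k (logpt s' t') - k (logpt s t) - c * Complex (s' - s) (t' - t)) <=
    e * (`|s' - s| + `|t' - t|).
Proof.
move=> /differentiable_cder; set c := derive1 _ _ => kd.
exists (c * logpt s t) => e e0.
pose M : R := expR s + 1; have M1 : 1 <= M by rewrite /M; have := expR_ge0 s; lra.
pose e1 := e / (2 * M); have e10 : 0 < e1 by apply: divr_gt0 => //; lra.
have [d1 d10 H1] := kd _ e10.
pose e2 := Num.min 1 (e / (2 * (cabs c + 1))).
have c0 := cabs_ge0 c.
have e20 : 0 < e2 by rewrite lt_min ltr01 /=; apply: divr_gt0 => //; lra.
have [d2 d20 H2] := @logpt_approx s t e2 e20.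
have e2c : cabs c * e2 <= e / 2.
  apply: (@le_trans _ _ ((cabs c + 1) * (e / (2 * (cabs c + 1))))).
    apply: ler_pM => //; [exact: ltW|lra|by rewrite ge_min lexx orbT].
  by rewrite le_eqVlt; apply/orP; left; apply/eqP; field; lra.
exists (Num.min d2 (d1 / (2 * M))).
  by rewrite lt_min d20 /=; apply: divr_gt0 => //; lra.
move=> s' t'; rewrite !lt_min => /andP[s1 s2] /andP[t1 t2].
have {}H2 := H2 _ _ s1 t1.
set u : C := Complex (s' - s) (t' - t) in H2 *.
set S := `|s' - s| + `|t' - t| in H2 *.
have S0 : 0 <= S by rewrite addr_ge0.
have uS : cabs u <= S by exact: (cabs_le_ReIm u).
have dE : cabs (logpt s' t' - logpt s t) <= M * S.
  have -> : logpt s' t' - logpt s t = (logpt s' t' - logpt s t - logpt s t * u) + logpt s t * u.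
    by ring.
  apply: (le_trans (cabsD _ _)); rewrite cabsM cabs_logpt /M mulrDl mul1r addrC.
  apply: lerD; first by apply: ler_wpM2l => //; exact: expR_ge0.
  apply: (le_trans H2); rewrite -[leRHS]mul1r; apply: ler_wpM2r => //.
  by rewrite ge_min lexx.
have {}H1 : cabs (k (logpt s' t') - k (logpt s t) - c * (logpt s' t' - logpt s t)) <= e1 * (M * S).
  apply: (@le_trans _ _ (e1 * cabs (logpt s' t' - logpt s t))).
    apply: H1; apply: (le_lt_trans dE); rewrite mulrC -ltr_pdivlMr; last lra.
    have -> : d1 / M = d1 / (2 * M) + d1 / (2 * M) by field; lra.
    exact: ltrD.
  by apply: ler_wpM2l => //; exact: ltW.
have -> : k (logpt s' t') - k (logpt s t) - c * logpt s t * u =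
  (k (logpt s' t') - k (logpt s t) - c * (logpt s' t' - logpt s t)) +
  c * (logpt s' t' - logpt s t - logpt s t * u) by ring.
apply: (le_trans (cabsD _ _)); rewrite cabsM.
have -> : e * S = e1 * (M * S) + e / 2 * S.
  by rewrite /e1; field; lra.
apply: lerD => //; apply: le_trans (ler_wpM2r S0 e2c).
by rewrite -mulrA; apply: ler_wpM2l.
Qed.

Lemma comp_logpt_cont s t : differentiable k (logpt s t) ->
  forall e, 0 < e -> exists2 d : R, 0 < d &
  forall s' t', `|s' - s| < d -> `|t' - t| < d ->
  cabs (k (logpt s' t') - k (logpt s t)) < e.
Proof.
move=> /comp_logpt_approx [c H] e e0.
have [d d0 {}H] := H 1 ltr01.
have c0 := cabs_ge0 c.
exists (Num.min d (e / (2 * (cabs c + 1)))).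
  by rewrite lt_min d0 /=; apply: divr_gt0 => //; lra.
move=> s' t'; rewrite !lt_min => /andP[s1 s2] /andP[t1 t2].
have {}H := H _ _ s1 t1.
rewrite -(subrK (c * Complex (s' - s) (t' - t)) (k _ - _)).
apply: (le_lt_trans (cabsD _ _)); rewrite cabsM.
have uS := cabs_le_ReIm (Complex (s' - s) (t' - t) : C).
move: uS; rewrite /= => uS.
have {uS} := ler_wpM2l c0 uS.
move: H; rewrite mul1r; set S := `|s' - s| + `|t' - t| => H H'.
have : S < e / (cabs c + 1).
  have -> : e / (cabs c + 1) = e / (2 * (cabs c + 1)) + e / (2 * (cabs c + 1)) by field; lra.
  exact: ltrD.
rewrite ltr_pdivlMr; lra.
Qed.

End Comp.
End LogCoordinates.

(** * Mean values on circles *)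

Section MeanValue.
Variable R : realType.
Local Notation C := (Cx R).
Implicit Types (s t e : R).

Lemma logpt_2pi s : logpt s (2 * pi) = logpt s 0.
Proof. by rewrite /logpt mulr_natl cos2pi sin2pi cos0 sin0. Qed.

Lemma twopi_gt0 : 0 < 2 * pi :> R.
Proof. by rewrite mulr_gt0 // pi_gt0. Qed.

Section OnDisc.
Variable k : C -> C.
Hypothesis kd : forall z, cabs z < 1 -> differentiable k z.

(** [P ds + Q dt] is the imaginary part of [k (logpt s t)] times ds + i dt. *)
Let P s t := complex.Im (k (logpt s t)).
Let Q s t := complex.Re (k (logpt s t)).

Let kdl s t : s < 0 -> differentiable k (logpt s t).
Proof. by move=> s0; apply: kd; rewrite cabs_logpt -expR0 ltr_expR. Qed.

Let contP t s : s < 0 -> {for s, continuous (P ^~ t)}.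
Proof.
move=> s0; apply/cvgrPdist_lt => e e0; apply/nbhs_normP.
have [d d0 H] := comp_logpt_cont (kdl t s0) e0.
exists d => // s' /= Hs'; rewrite -ImB; apply: (le_lt_trans (Im_le_cabs _)).
by rewrite cabsBC; apply: H; rewrite ?subrr ?normr0 // distrC.
Qed.

Let contQ t s : s < 0 -> {for t, continuous (Q s)}.
Proof.
move=> s0; apply/cvgrPdist_lt => e e0; apply/nbhs_normP.
have [d d0 H] := comp_logpt_cont (kdl t s0) e0.
exists d => // t' /= Ht'; rewrite -ReB; apply: (le_lt_trans (Re_le_cabs _)).
by rewrite cabsBC; apply: H; rewrite ?subrr ?normr0 // distrC.
Qed.

(* The circulation of k(e^(s+it)) (ds + i dt) around [s1, s0] x [0, 2 pi]
   vanishes and the horizontal sides cancel by periodicity; the two vertical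
   sides are then evaluated by the mean value theorem. *)
Lemma mean_values_circles s1 s0 : s1 <= s0 -> s0 < 0 ->
  exists t1 t0, complex.Re (k (logpt s1 t1)) = complex.Re (k (logpt s0 t0)).
Proof.
move=> s10 s00; have p0 := twopi_gt0.
(* Antiderivatives are differentiable only inside the interval on which they are built, so the sides
   are enlarged. The bound s0 / 2 lies strictly between s0 and 0, hence stays where [k] is
   differentiable; for s >= 0 the function [B s] below is an arbitrary default. *)
have /choice [A HA] : forall t, exists F : R -> R, forall s, s1 - 1 < s < s0 / 2 ->
    is_derive s (1 : R) F (P s t).
  move=> t; apply: antiderivative_exists; first lra.
  by move=> s /andP[_ ?]; apply: contP; lra.
have /choice [B HB] : forall s, exists F : R -> R, s < 0 -> forall t,
    -1 < t < 2 * pi + 1 -> is_derive t (1 : R) F (Q s t).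
  move=> s; have [sn|sn] := ltP s 0; last by exists (fun=> 0).
  have [|F HF] := @antiderivative_exists R (Q s) (-1) (2 * pi + 1) ltac:(lra).
    by move=> t _; apply: contQ.
  by exists F.
have G : rect_circ (fun s t => A t s) B s1 s0 0 (2 * pi) = 0.
  apply: (@goursat_rectangle _ _ _ P Q) => //; first exact: ltW.
    move=> s t /andP[? ?] /andP[? ?]; split.
      by apply: HA; apply/andP; split; lra.
    by apply: HB; [lra|apply/andP; split; lra].
  move=> s t /andP[_ ?] _; have sn : s < 0 by lra.
  have [c Hc] := comp_logpt_approx (kdl t sn).
  (* The slopes are read off the imaginary and real parts of c (ds + i dt). *)
  exists (complex.Im c), (complex.Re c), (- complex.Im c) => e e0.
  have [d d0 H] := Hc e e0; exists d => // s' t' Hs Ht.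
  have {}H := H _ _ Hs Ht; split.
    apply: le_trans (le_trans (Im_le_cabs _) H).
    rewrite !ImB ImM /= le_eqVlt; apply/orP; left; apply/eqP; congr `|_|.
    by rewrite /P; ring.
  apply: le_trans (le_trans (Re_le_cabs _) H).
  rewrite !ReB ReM /= le_eqVlt; apply/orP; left; apply/eqP; congr `|_|.
  by rewrite /Q; ring.
have [xi _ E1] := @MVT_closed R (fun s => A 0 s - A (2 * pi) s)
    (fun s => P s 0 - P s (2 * pi)) s1 s0 s10 ltac:(
      by move=> s /andP[? ?]; apply: is_deriveB; apply: HA; apply/andP; split; lra).
have [t1 _ E2] := @MVT_closed R (B s1) (Q s1) 0 (2 * pi) ltac:(lra) ltac:(
      by move=> t /andP[? ?]; apply: HB; [lra|apply/andP; split; lra]).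
have [t0 _ E3] := @MVT_closed R (B s0) (Q s0) 0 (2 * pi) ltac:(lra) ltac:(
      by move=> t /andP[? ?]; apply: HB; [lra|apply/andP; split; lra]).
exists t1, t0; move: G; rewrite /rect_circ.
move: E1; rewrite /P logpt_2pi subrr mul0r => E1.
have -> : A 0 s0 - A 0 s1 - (A (2 * pi) s0 - A (2 * pi) s1) + (B s0 (2 * pi) - B s0 0) -
   (B s1 (2 * pi) - B s1 0) = (A 0 s0 - A (2 * pi) s0 - (A 0 s1 - A (2 * pi) s1)) +
   (B s0 (2 * pi) - B s0 0) - (B s1 (2 * pi) - B s1 0) by ring.
rewrite E1 E2 E3 add0r subr0 -mulrBl => /eqP; rewrite mulf_eq0 subr_eq0 => /orP[|] /eqP.
  by rewrite /Q => ->.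
by move=> pE; move: p0; rewrite pE ltxx.
Qed.

(** If the real part at 0 exceeded [M], by continuity it would do so on a whole tiny circle;
    [mean_values_circles] carries one of these values over to the circle of radius [rho], where it
    is forbidden. *)
Lemma center_Re_le rho M : 0 < rho < 1 ->
  (forall z, cabs z = rho -> complex.Re (k z) <= M) -> complex.Re (k 0) <= M.
Proof.
move=> /andP[r0 r1] H; rewrite leNgt; apply/negP => M0.
have [d d0 Hd] := differentiable_ccont (kd (ltac:(rewrite cabs0 //) : cabs (0 : C) < 1))
  (ltac:(rewrite subr_gt0 //) : 0 < complex.Re (k 0) - M).
pose s1 := ln (Num.min rho (d / 2)).
have m0 : 0 < Num.min rho (d / 2) by rewrite lt_min r0 divr_gt0.
have [|| t1 [t0 E]] := @mean_values_circles s1 (ln rho).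
- by rewrite ler_ln ?posrE // ge_min lexx.
- by apply: ln_lt0; rewrite r0.
have := H (logpt (ln rho) t0); rewrite cabs_logpt lnK ?posrE // => /(_ erefl).
rewrite -E; have := Hd (logpt s1 t1); rewrite subr0 cabs_logpt lnK ?posrE //.
have md : Num.min rho (d / 2) < d by rewrite gt_min; apply/orP; right; lra.
move=> /(_ md) h; have := le_lt_trans (Re_le_cabs _) h.
by rewrite ReB ltr_norml => /andP[? ?]; lra.
Qed.

End OnDisc.

Lemma center_cabs_le (k : C -> C) rho M :
  (forall z, cabs z < 1 -> differentiable k z) -> 0 < rho < 1 ->
  (forall z, cabs z = rho -> cabs (k z) <= M) -> cabs (k 0) <= M.
Proof.
move=> kd r01 H.
have [k0|k0] := eqVneq (k 0) 0.
  rewrite k0 cabs0; have := H (toC rho); rewrite cabs_real ger0_norm.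
    by move=> /(_ erefl); exact: le_trans (cabs_ge0 _).
  by case/andP: r01 => /ltW.
(* The rotation by [u] makes the value at 0 equal to its modulus, so that the bound on real parts
   becomes a bound on moduli. *)
pose u := Num.conj (k 0) / toC (cabs (k 0)).
have cu : cabs u = 1.
  by rewrite /u cabsM cabsV cabs_real cabs_conj ger0_norm ?cabs_ge0 // divff // cabs_eq0.
pose g z := u * k z.
have gd z : cabs z < 1 -> differentiable g z.
  by move=> z1; apply: (differentiableZ u); exact: kd.
have : complex.Re (g 0) <= M.
  apply: (center_Re_le gd r01) => z /H; apply: le_trans; apply: le_trans (ler_norm _) _.
  by apply: le_trans (Re_le_cabs _) _; rewrite /g cabsM cu mul1r.
have -> // : g 0 = toC (cabs (k 0)).
rewrite /g /u mulrAC [_ * k 0]mulrC mul_conj toCX expr2 mulfK //.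
by rewrite -toC0 (inj_eq (@toC_inj R)) cabs_eq0.
Qed.

End MeanValue.

Lemma differentiable_id (K : numFieldType) (V : normedModType K) (x : V) :
  differentiable (id : V -> V) x.
Proof. exact: ex_diff. Qed.

Lemma differentiable_pow (K : numFieldType) (V : normedModType K) (f : V -> K) n x :
  differentiable f x -> differentiable (fun y => f y ^+ n) x.
Proof.
move=> fx; elim: n => [|n IH].
  by under eq_fun do rewrite expr0; exact: differentiable_cst.
by under eq_fun do rewrite exprS; exact: differentiableM.
Qed.

(** * Moebius automorphisms of the disc *)

Section Moebius.
Variable R : realType.
Local Notation C := (Cx R).
Implicit Types (a b z w : C).

Definition moebius a z : C := (z - a) / (1 - Num.conj a * z).

Lemma moebius_den a z : cabs a < 1 -> cabs z <= 1 -> 1 - Num.conj a * z != 0.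
Proof.
move=> a1 z1; rewrite subr_eq0; apply/eqP => E.
have : cabs (Num.conj a * z) = 1 by rewrite -E cabs1.
rewrite cabsM cabs_conj; have := cabs_ge0 a; have := cabs_ge0 z; nra.
Qed.

Lemma moebius_identity a z :
  cabs (1 - Num.conj a * z) ^+ 2 - cabs (z - a) ^+ 2 =
  (1 - cabs a ^+ 2) * (1 - cabs z ^+ 2).
Proof.
rewrite !sqr_cabs !(ReB, ImB, ReM, ImM, Re_conj, Im_conj) /=; ring.
Qed.

Lemma cabs_moebius2 a z : cabs a < 1 -> cabs z <= 1 ->
  1 - cabs (moebius a z) ^+ 2 =
  (1 - cabs a ^+ 2) * (1 - cabs z ^+ 2) / cabs (1 - Num.conj a * z) ^+ 2.
Proof.
move=> a1 z1; have d0 := moebius_den a1 z1.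
rewrite -moebius_identity /moebius cabsM cabsV.
by field; rewrite cabs_eq0.
Qed.

Lemma cabs_moebius_lt1 a z : cabs a < 1 -> cabs z < 1 -> cabs (moebius a z) < 1.
Proof.
move=> a1 z1; have := cabs_moebius2 a1 (ltW z1).
have : 0 < (1 - cabs a ^+ 2) * (1 - cabs z ^+ 2) / cabs (1 - Num.conj a * z) ^+ 2.
  apply: divr_gt0; last by rewrite exprn_gt0 // cabs_gt0 moebius_den // ltW.
  by apply: mulr_gt0; [have := cabs_ge0 a|have := cabs_ge0 z]; nra.
move=> + E; rewrite -E subr_gt0 -[ltRHS](expr1n _ 2) ltr_pXn2r ?nnegrE ?cabs_ge0 //.
Qed.

Lemma moebiusxx a : moebius a a = 0.
Proof. by rewrite /moebius subrr mul0r. Qed.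

Lemma moebiusx0 a : moebius a 0 = - a.
Proof. by rewrite /moebius mulr0 subr0 invr1 mulr1 sub0r. Qed.

Lemma moebius0x z : moebius 0 z = z.
Proof. by rewrite /moebius conjC0 mul0r !subr0 divr1. Qed.

Lemma moebius_eq0 a z : cabs a < 1 -> cabs z <= 1 -> (moebius a z == 0) = (z == a).
Proof.
move=> a1 z1; rewrite /moebius mulf_eq0 invr_eq0 (negbTE (moebius_den a1 z1)) orbF.
by rewrite subr_eq0.
Qed.

Lemma moebiusK a z : cabs a < 1 -> cabs z < 1 -> moebius (- a) (moebius a z) = z.
Proof.
move=> a1 z1; have d1 := moebius_den a1 (ltW z1).
have h : cabs (- a) < 1 by rewrite cabsN.
have d3 := moebius_den h (ltW (cabs_moebius_lt1 a1 z1)).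
apply: (mulIf d3); rewrite [moebius (- a) _]/moebius divfK //.
by rewrite /moebius rmorphN; field.
Qed.

Lemma differentiable_moebius a z : cabs a < 1 -> cabs z < 1 ->
  differentiable (moebius a) z.
Proof.
move=> a1 z1; rewrite /moebius.
have -> : (fun w => (w - a) / (1 - Num.conj a * w)) =
   (fun w => w - a) * (fun w => (1 - Num.conj a * w)^-1) by [].
apply: differentiableM.
  by apply: differentiableB; [exact: differentiable_id|exact: differentiable_cst].
apply: differentiableV; last exact: moebius_den (ltW z1).
apply: differentiableB; first exact: differentiable_cst.
by apply: (@differentiableZ _ _ _ id); exact: differentiable_id.
Qed.

(** Moebius maps are proper on the open disc. With u = 1 - rho^2, this [r] gives 1 - |z|^2 <= u (1 -
    |a|) / 2; with 1 - |a|^2 <= 2 (1 - |a|) and a denominator of modulus at least 1 - |a|,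
    [cabs_moebius2] yields 1 - |moebius a z|^2 <= u. *)
Lemma cabs_moebius_near1 a (rho : R) : cabs a < 1 -> 0 <= rho < 1 ->
  exists2 r : R, 0 < r < 1 & forall z, r <= cabs z < 1 -> rho <= cabs (moebius a z).
Proof.
move=> a1 /andP[r0 r1]; have a0 := cabs_ge0 a.
have u0 : 0 < 1 - rho ^+ 2 by nra.
have u1 : 1 - rho ^+ 2 <= 1 by nra.
set u := 1 - rho ^+ 2 in u0 u1.
have uv0 : 0 < u * (1 - cabs a) by apply: mulr_gt0 => //; lra.
have uv1 : u * (1 - cabs a) <= 1 by nra.
exists (1 - u * (1 - cabs a) / 4); first by apply/andP; split; lra.
move=> z /andP[rz z1]; have d0 := moebius_den a1 (ltW z1).
have z0 := cabs_ge0 z.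
have D : 1 - cabs a <= cabs (1 - Num.conj a * z).
  have := cabs_distD 1 (Num.conj a * z); rewrite cabs1 cabsM cabs_conj.
  by nra.
rewrite -(@ler_pXn2r _ 2) ?nnegrE ?cabs_ge0 //.
have := cabs_moebius2 a1 (ltW z1).
set t := _ / _ => Et.
suff : t <= u by rewrite /u; lra.
rewrite /t ler_pdivrMr; last by rewrite exprn_gt0 // cabs_gt0.
apply: (@le_trans _ _ (u * (1 - cabs a) ^+ 2)); last first.
  by apply: ler_wpM2l; [exact: ltW | rewrite ler_pXn2r ?nnegrE ?cabs_ge0 //; lra].
have h : 1 - cabs z ^+ 2 <= u * (1 - cabs a) / 2 by nra.
have y2 : 0 <= 1 - cabs a ^+ 2 by nra.
have y3 : (1 - cabs a ^+ 2) <= 2 * (1 - cabs a) by nra.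
apply: (le_trans (ler_wpM2l y2 h)).
have h3 : 0 <= u * (1 - cabs a) / 2 by lra.
apply: (le_trans (ler_wpM2r h3 y3)).
by rewrite le_eqVlt; apply/orP; left; apply/eqP; field.
Qed.

End Moebius.

(** * Maximum principles, with and without exceptional points *)

Section MaximumPrinciple.
Variable R : realType.
Local Notation C := (Cx R).
Implicit Types (k : C -> C) (a b z w : C) (M rho : R).

(** A Moebius map moves [a] to the centre, and properness sends a circle close to the boundary into
    the annulus. The annulus stands in for the unit circle, on which nothing is assumed about
    [k]. *)
Lemma maximum_principle k rho M a :
  (forall z, cabs z < 1 -> differentiable k z) -> 0 <= rho < 1 ->
  (forall z, rho <= cabs z < 1 -> cabs (k z) <= M) ->
  cabs a < 1 -> cabs (k a) <= M.
Proof.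
move=> kd rho1 kM a1; have Na1 : cabs (- a) < 1 by rewrite cabsN.
have [r /andP[r0 r1] Hr] := cabs_moebius_near1 Na1 rho1.
have -> : k a = (k \o moebius (- a)) 0 by rewrite /= moebiusx0 opprK.
apply: (@center_cabs_le _ _ r).
- move=> z z1; apply: differentiable_comp; first exact: differentiable_moebius.
  by apply: kd; exact: cabs_moebius_lt1.
- by rewrite r0.
- move=> z zr; apply: kM; rewrite Hr ?zr ?lexx //= cabs_moebius_lt1 // zr //.
Qed.

Lemma le_of_expr_le (x M c : R) : 0 < c -> 0 <= M ->
  (forall n, x ^+ n * c <= M ^+ n) -> x <= M.
Proof.
move=> c0 M0 H; rewrite leNgt; apply/negP => Mx.
have x0 : 0 < x by exact: le_lt_trans Mx.
have : ((M / x) ^+ n @[n --> \oo]) --> (0 : R).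
  by apply: cvg_expr; rewrite ger0_norm ?divr_ge0 // ?(ltW x0) // ltr_pdivrMr // mul1r.
move=> /cvgrPdist_lt /(_ _ c0) [N _ /(_ N (leqnn _))] /=.
rewrite sub0r normrN ger0_norm ?exprn_ge0 ?divr_ge0 // ?(ltW x0) //.
rewrite expr_div_n ltr_pdivrMr ?exprn_gt0 // => h.
by have := H N; rewrite mulrC leNgt h.
Qed.

Lemma ccont_continuous k z : ccont k z -> {for z, continuous k}.
Proof.
move=> H; apply: rnorm_continuous => e /H [d d0 Hd].
by exists d => // w; rewrite !rnorm_cabs; apply: Hd.
Qed.

Lemma continuous_ccont k z : {for z, continuous k} -> ccont k z.
Proof.
move=> /continuous_rnorm H e /H [d d0 Hd].
by exists d => // w; rewrite -!rnorm_cabs; apply: Hd.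
Qed.

(** The difference quotient of the product at [b] is [k] itself, so continuity of [k] gives the
    derivative [k b]. *)
Lemma differentiable_mul_root k b : {for b, continuous k} ->
  differentiable (fun z => k z * (z - b)) b.
Proof.
move=> /continuous_ccont kc.
apply: (fun H => (@cder_differentiable R _ b (k b) H).1) => e e0.
have [d d0 Hd] := kc e e0; exists d => // w Hw.
rewrite subrr mulr0 subr0 -mulrBl cabsM; apply: ler_wpM2r; first exact: cabs_ge0.
exact/ltW/Hd.
Qed.

(* Multiplying k^n by (z - b1)(z - b2) removes the singularities without
   affecting the boundary values much; the factor disappears as n grows. *)
Lemma maximum_principle_except k rho M b1 b2 a : cabs b1 < 1 -> cabs b2 < 1 ->
  {for b1, continuous k} -> {for b2, continuous k} ->
  (forall z, cabs z < 1 -> z != b1 -> z != b2 -> differentiable k z) -> 0 <= rho < 1 ->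
  (forall z, rho <= cabs z < 1 -> cabs (k z) <= M) ->
  0 <= M -> cabs a < 1 -> a != b1 -> a != b2 -> cabs (k a) <= M.
Proof.
move=> b11 b21 c1 c2 kd rho1 kM M0 a1 ab1 ab2.
(* Each of |z - b1| and |z - b2| is at most 2 on the disc; dividing by 4 keeps the auxiliary
   function below M^n on the annulus. *)
apply: (@le_of_expr_le _ _ (cabs (a - b1) * cabs (a - b2) / 4)) => //.
  by rewrite divr_gt0 // mulr_gt0 // cabs_gt0 subr_eq0.
case=> [|n].
  rewrite !expr0 mul1r ler_pdivrMr // mul1r.
  have := cabsB a b1; have := cabsB a b2.
  have := cabs_ge0 (a - b1); have := cabs_ge0 (a - b2); nra.
pose g z := k z ^+ n.+1 * (z - b1) * (z - b2) / 4.
have cX z : {for z, continuous k} -> {for z, continuous (fun w => k w ^+ n.+1)}.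
  move=> kz; apply: (@continuous_comp _ _ _ k (fun w => w ^+ n.+1) z kz).
  apply: differentiable_continuous.
  by apply: (@differentiable_pow _ _ id); exact: differentiable_id.
have dS z b : differentiable (fun w : C => w - b) z.
  by apply: differentiableB; [exact: differentiable_id|exact: differentiable_cst].
have cS z b : {for z, continuous (fun w : C => w - b)}.
  exact: differentiable_continuous (dS z b).
have gd z : cabs z < 1 -> differentiable g z.
  move=> z1.
  apply: (@differentiableM _ _ (fun z => k z ^+ n.+1 * (z - b1) * (z - b2))
    (cst (4^-1 : C))); last exact: differentiable_cst.
  have [->|zb2] := eqVneq z b2.
    apply: (@differentiable_mul_root (fun z => k z ^+ n.+1 * (z - b1))).
    exact: (continuousM (cX _ c2) (cS _ b1)).
  apply: differentiableM; last exact: dS.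
  have [->|zb1] := eqVneq z b1.
    by apply: (@differentiable_mul_root (fun z => k z ^+ n.+1)); exact: cX _ c1.
  by apply: differentiableM; [apply: differentiable_pow; exact: kd|exact: dS].
have : cabs (g a) <= M ^+ n.+1.
  apply: (maximum_principle gd rho1) => // z zI.
  have z1 : cabs z < 1 by case/andP: zI.
  rewrite /g !cabsM cabsV cabsX.
  have -> : cabs (4 : C) = 4.
    by have -> : (4 : C) = toC 4; [rewrite /toC rmorph_nat|rewrite cabs_real ger0_norm].
  have kM' : cabs (k z) ^+ n.+1 <= M ^+ n.+1.
    by rewrite ler_pXn2r ?nnegrE ?cabs_ge0 // kM.
  have : cabs (z - b1) * cabs (z - b2) <= 4.
    have := cabsB z b1; have := cabsB z b2.
    by have := cabs_ge0 (z - b1); have := cabs_ge0 (z - b2); nra.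
  move: kM'; have : 0 <= cabs (k z) ^+ n.+1 by rewrite exprn_ge0 // cabs_ge0.
  have : 0 <= cabs (z - b1) * cabs (z - b2) by rewrite mulr_ge0 ?cabs_ge0.
  rewrite ler_pdivrMr // -mulrA; set x := cabs (k z) ^+ _; set y := M ^+ _.
  set u := cabs _ * _ => u0 x0 xy u4.
  by apply: ler_pM.
rewrite /g !cabsM cabsV cabsX.
have -> : cabs (4 : C) = 4.
  by have -> : (4 : C) = toC 4; [rewrite /toC rmorph_nat|rewrite cabs_real ger0_norm].
by rewrite !mulrA.
Qed.

End MaximumPrinciple.

(** * Pick inequalities for functions that are only continuous at 0 *)

Section SchwarzPick.
Variable R : realType.
Local Notation C := (Cx R).
Implicit Types (f g q : C -> C) (a b c z w : C).

Definition slope f b c z : C := if z == b then c else (f z - f b) / (z - b).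

Lemma slope_neq f b c z : z != b -> slope f b c z = (f z - f b) / (z - b).
Proof. by rewrite /slope => /negbTE ->. Qed.

Lemma slope_near f b c z : z != b -> exists2 d : R, 0 < d &
  forall w, cabs (w - z) < d -> slope f b c w = (f w - f b) / (w - b).
Proof.
move=> zb; exists (cabs (z - b)); first by rewrite cabs_gt0 subr_eq0.
move=> w wz; apply: slope_neq; apply/eqP => wb.
by move: wz; rewrite wb cabsBC ltxx.
Qed.

Lemma differentiable_near_eq f g z :
  (exists2 d : R, 0 < d & forall w, cabs (w - z) < d -> g w = f w) ->
  differentiable f z -> differentiable g z.
Proof.
move=> [d d0 H] /differentiable_cder fd.
apply: (fun H => (@cder_differentiable R _ z (derive1 f z) H).1) => e e0.
have [d1 d10 H1] := fd e e0; exists (Num.min d d1); first by rewrite lt_min d0.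
move=> w; rewrite lt_min => /andP[wd wd1]; rewrite !H //; last by rewrite subrr cabs0.
exact: H1.
Qed.

Lemma continuous_near_eq f g z :
  (exists2 d : R, 0 < d & forall w, cabs (w - z) < d -> g w = f w) ->
  {for z, continuous f} -> {for z, continuous g}.
Proof.
move=> [d d0 H] /continuous_ccont fd; apply: ccont_continuous => e e0.
have [d1 d10 H1] := fd e e0; exists (Num.min d d1); first by rewrite lt_min d0.
move=> w; rewrite lt_min => /andP[wd wd1]; rewrite !H //; last by rewrite subrr cabs0.
exact: H1.
Qed.

Lemma continuous_comp_cx f g z : {for z, continuous f} -> {for f z, continuous g} ->
  {for z, continuous (fun w => g (f w))}.
Proof.
move=> /continuous_ccont fc /continuous_ccont gc; apply: ccont_continuous => e.
move=> /gc [d1 d10 H1]; have [d2 d20 H2] := fc _ d10.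
by exists d2 => // w /H2 /H1.
Qed.

Lemma continuous_mul_cx f g z : {for z, continuous f} -> {for z, continuous g} ->
  {for z, continuous (fun w => f w * g w)}.
Proof. by move=> fc gc; exact: (continuousM fc gc). Qed.

Lemma differentiable_sub_cst f c z : differentiable f z ->
  differentiable (fun w => f w - c) z.
Proof. by move=> fd; apply: differentiableB => //; exact: differentiable_cst. Qed.

Lemma differentiable_inv_sub b z : z != b -> differentiable (fun w : C => (w - b)^-1) z.
Proof.
move=> zb; apply: differentiableV; last by rewrite subr_eq0.
exact/differentiable_sub_cst/differentiable_id.
Qed.

Lemma slope_differentiable f b c z : z != b -> differentiable f z ->
  differentiable (slope f b c) z.
Proof.
move=> zb fd; apply: differentiable_near_eq (slope_near f c zb) _.
apply: (@differentiableM _ _ (fun w => f w - f b) (fun w => (w - b)^-1)).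
  exact: differentiable_sub_cst.
exact: differentiable_inv_sub.
Qed.

Lemma slope_continuous_off f b c z : z != b -> {for z, continuous f} ->
  {for z, continuous (slope f b c)}.
Proof.
move=> zb fd; apply: continuous_near_eq (slope_near f c zb) _.
apply: (@continuousM _ _ (fun w => f w - f b) (fun w => (w - b)^-1)).
  apply: ccont_continuous => e /(continuous_ccont fd) [d d0 H].
  by exists d => // w /H; rewrite opprB addrA subrK.
exact/differentiable_continuous/differentiable_inv_sub.
Qed.

Lemma slope_continuous f b c : cder f b c -> {for b, continuous (slope f b c)}.
Proof.
move=> fd; apply: ccont_continuous => e e0.
have [d d0 H] := fd (e / 2) ltac:(lra); exists d => // w wb.
have sb : slope f b c b = c by rewrite /slope eqxx.
have [->|wNb] := eqVneq w b; first by rewrite subrr cabs0.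
rewrite sb slope_neq //.
have w0 : w - b != 0 by rewrite subr_eq0.
have w0' : 0 < cabs (w - b) by rewrite cabs_gt0.
have -> : (f w - f b) / (w - b) - c = (f w - f b - c * (w - b)) / (w - b) by field.
rewrite cabsM cabsV ltr_pdivrMr //; apply: (le_lt_trans (H w wb)).
by rewrite ltr_pM2r //; lra.
Qed.

(** The class contains the difference quotient at 0 of a holomorphic function, which is known to be
    continuous there and differentiable elsewhere. *)
Definition in_disc_except f : Prop :=
  {for (0 : C), continuous f} /\ (forall z, cabs z < 1 -> z != 0 -> differentiable f z).

(** The function [K] is the quotient of [moebius (q b) (q w)] by [moebius b w], with its value at
    [b] filled in. It has two exceptional points, 0 inherited from [q] and [b] from the division,
    whence the two points in [maximum_principle_except]. *)
Lemma pick_except_strict q z b : in_disc_except q ->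
  (forall z, cabs z < 1 -> cabs (q z) < 1) ->
  cabs z < 1 -> cabs b < 1 -> z != 0 -> b != 0 ->
  cabs (moebius (q b) (q z)) <= cabs (moebius b z).
Proof.
move=> [qc qd] q1 z1 b1 z0 b0.
have [->|zb] := eqVneq z b; first by rewrite !moebiusxx.
pose m w := moebius (q b) (q w).
have q01 : cabs (q 0) < 1 by apply: q1; rewrite cabs0.
have md w : cabs w < 1 -> w != 0 -> differentiable m w.
  move=> w1 w0; apply: (@differentiable_comp _ _ _ _ q (moebius (q b))); first exact: qd.
  by apply: differentiable_moebius; exact: q1.
have mc : {for (0 : C), continuous m}.
  apply: (continuous_comp_cx qc).
  apply: differentiable_continuous; apply: differentiable_moebius => //; exact: q1.
have mb : m b = 0 by rewrite /m moebiusxx.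
pose K w := slope m b (derive1 m b) w * (1 - Num.conj b * w).
have dl w : differentiable (fun w : C => 1 - Num.conj b * w) w.
  apply: differentiableB; first exact: differentiable_cst.
  by apply: (@differentiableZ _ _ _ id); exact: differentiable_id.
have KE w : cabs w < 1 -> w != b -> cabs (K w) = cabs (m w) / cabs (moebius b w).
  move=> w1 wb; rewrite /K slope_neq // mb subr0 /moebius !cabsM !cabsV invfM invrK.
  by rewrite !mulrA.
have mz0 : 0 < cabs (moebius b z) by rewrite cabs_gt0 moebius_eq0 // ltW.
suff : cabs (K z) <= 1 by rewrite KE // ler_pdivrMr // mul1r.
apply/ler_addgt0Pr => e e0.
have e1 : 0 < 1 + e by lra.
(* Near the boundary |moebius b w| >= 1 / (1 + e), so the numerator bound 1 becomes the bound 1 + e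
   for [K]. *)
have rho1 : 0 <= (1 + e)^-1 < 1.
  by rewrite invr_ge0 (ltW e1) invf_lt1 // ltrDl.
have [r /andP[r0 r1] Hr] := cabs_moebius_near1 b1 rho1.
have z01 : cabs (0 : C) < 1 by rewrite cabs0.
have dlc w : {for w, continuous (fun w : C => 1 - Num.conj b * w)}.
  exact: differentiable_continuous (dl w).
have c0 : {for (0 : C), continuous K}.
  have nb : 0 != b by rewrite eq_sym.
  exact: (continuous_mul_cx (@slope_continuous_off m b (derive1 m b) 0 nb mc) (dlc 0)).
have cb : {for b, continuous K}.
  exact: (continuous_mul_cx (slope_continuous (differentiable_cder (md b b1 b0))) (dlc b)).
have Kd w : cabs w < 1 -> w != 0 -> w != b -> differentiable K w.
  move=> w1 w0 wb.
  exact: (differentiableM (@slope_differentiable m b (derive1 m b) w wb (md w w1 w0)) (dl w)).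
have r01 : 0 <= r < 1 by rewrite (ltW r0).
apply: (maximum_principle_except z01 b1 c0 cb Kd r01) z1 z0 zb; last exact: ltW.
move=> w /[dup] wI /andP[rw w1]; have := Hr w wI => h.
have wb : w != b.
  by apply/eqP => wb; move: h; rewrite wb moebiusxx cabs0 leNgt invr_gt0 e1.
rewrite KE //.
have mw0 : 0 < cabs (moebius b w) by rewrite cabs_gt0 moebius_eq0 // ltW.
rewrite ler_pdivrMr //; apply: (@le_trans _ _ 1).
  by apply/ltW/cabs_moebius_lt1; exact: q1.
by rewrite mulrC -ler_pdivrMr // mul1r.
Qed.

(** The denominator of [moebius (q b) (q z)] can vanish when [q] is only bounded by 1, so it is
    multiplied out. The inequality follows from the strict case for t q, as t < 1 tends to 1. *)
Lemma pick_except q z b : in_disc_except q ->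
  (forall z, cabs z < 1 -> cabs (q z) <= 1) ->
  cabs z < 1 -> cabs b < 1 -> z != 0 -> b != 0 ->
  cabs (q z - q b) <= cabs (moebius b z) * cabs (1 - Num.conj (q b) * q z).
Proof.
move=> [qc qd] q1 z1 b1 z0 b0.
have qz1 := q1 z z1; have qb1 := q1 b b1.
have m1 := ltW (cabs_moebius_lt1 b1 z1); have m0 := cabs_ge0 (moebius b z).
set X := cabs (q z - q b); set W := Num.conj (q b) * q z.
have X2 : X <= 2 by apply: (le_trans (cabsB _ _)); lra.
have W1 : cabs W <= 1.
  by rewrite /W cabsM cabs_conj; apply: mulr_ile1 => //; exact: cabs_ge0.
suff H t : 0 < t < 1 -> t * X <= cabs (moebius b z) * cabs (1 - W) + (1 - t ^+ 2).
  apply/ler_addgt0Pr => e e0.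
  pose t : R := Num.max (1 / 2) (1 - e / 8).
  have t1 : 1 / 2 <= t by rewrite le_max lexx.
  have t2 : 1 - e / 8 <= t by rewrite le_max lexx orbT.
  have t3 : t < 1 by rewrite gt_max; apply/andP; split; lra.
  have := H t ltac:(apply/andP; split; lra).
  by have := cabs_ge0 (q z - q b); rewrite -/X; nra.
move=> /andP[t0 t1].
pose p w := toC t * q w.
have ct : cabs (toC t) = t by rewrite cabs_real gtr0_norm.
have pe : in_disc_except p.
  split; last by move=> w w1 w0; apply: (differentiableZ (toC t)); exact: qd.
  exact: (continuous_mul_cx (differentiable_continuous (differentiable_cst (toC t) 0)) qc).
have p1 w : cabs w < 1 -> cabs (p w) < 1.
  by move=> w1; rewrite /p cabsM ct; have := q1 w w1; have := cabs_ge0 (q w); nra.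
have := pick_except_strict pe p1 z1 b1 z0 b0.
have d0 := moebius_den (p1 _ b1) (ltW (p1 _ z1)).
rewrite {1}/moebius cabsM cabsV ler_pdivrMr ?cabs_gt0 //.
have -> : p z - p b = toC t * (q z - q b) by rewrite /p; ring.
have -> : 1 - Num.conj (p b) * p z = (1 - W) + toC (1 - t ^+ 2) * W.
  have -> : Num.conj (p b) = toC t * Num.conj (q b).
    apply: complex_ext; rewrite /p !(Re_conj, Im_conj, ReM, ImM, ReToC, ImToC); ring.
  by rewrite /W /p toCD toC1 toCN toCX; ring.
rewrite cabsM ct -/X => h; apply: (le_trans h).
have t2 : 0 <= 1 - t ^+ 2 by nra.
have : cabs (1 - W + toC (1 - t ^+ 2) * W) <= cabs (1 - W) + (1 - t ^+ 2).
  apply: (le_trans (cabsD _ _)); rewrite cabsM cabs_real ger0_norm // lerD2l.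
  by rewrite -[leRHS]mulr1; apply: ler_wpM2l.
move=> h2; apply: (le_trans (ler_wpM2l m0 h2)).
rewrite mulrDr lerD2l -[leRHS]mul1r; exact: ler_wpM2r.
Qed.

(** At b = 0 the function [q] may fail to be differentiable, so this case is the limit of
    [pick_except] for b = r > 0 tending to 0, by continuity of [q] at 0. *)
Lemma pick_except0 q z : in_disc_except q ->
  (forall z, cabs z < 1 -> cabs (q z) <= 1) -> cabs z < 1 ->
  cabs (q z - q 0) <= cabs z * cabs (1 - Num.conj (q 0) * q z).
Proof.
move=> qe q1 z1.
have [->|z0] := eqVneq z 0; first by rewrite subrr cabs0 mul0r.
apply/ler_addgt0Pr => e e0.
(* Replacing r by 0 costs at most 6 e1: 4 e1 in the product on the right, e1 for the factor 1 - r,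
   and e1 for replacing [q (toC r)] by [q 0] on the left. *)
pose e1 := Num.min 1 (e / 8).
have e10 : 0 < e1 by rewrite lt_min ltr01; lra.
have e11 : e1 <= 1 by rewrite ge_min lexx.
have e18 : 8 * e1 <= e.
  have : e1 <= e / 8 by rewrite ge_min lexx orbT.
  by lra.
have [d d0 Hd] := continuous_ccont qe.1 e10.
pose r : R := Num.min d e1 / 2.
have r0 : 0 < r by rewrite divr_gt0 // lt_min d0.
have re : r <= e1 / 2 by rewrite ler_wpM2r // ge_min lexx orbT.
have rd : r <= d / 2 by rewrite ler_wpM2r // ge_min lexx.
have cr : cabs (toC r) = r by rewrite cabs_real gtr0_norm.
have b1 : cabs (toC r) < 1 by rewrite cr; lra.
have b0 : toC r != 0 by rewrite -cabs_gt0 cr.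
have := Hd (toC r); rewrite subr0 cr => /(_ ltac:(lra)) qb.
have := pick_except qe q1 z1 b1 z0 b0.
have qz1 := q1 z z1; have qb1 := q1 _ b1.
have q01 : cabs (q 0) <= 1 by apply: q1; rewrite cabs0.
have D : 1 - r <= cabs (1 - Num.conj (toC r) * z).
  have := cabs_distD 1 (Num.conj (toC r) * z); rewrite cabs1 cabsM cabs_conj cr.
  by have := cabs_ge0 z; nra.
have D0 : 0 < cabs (1 - Num.conj (toC r) * z) by lra.
rewrite /moebius [cabs (_ / _)]cabsM cabsV mulrAC ler_pdivlMr // => h.
have X1 := cabs_ge0 (q z - q (toC r)).
have {h} h := le_trans (ler_wpM2l X1 D) h.
have F1 : cabs (q z - q 0) <= cabs (q z - q (toC r)) + e1.
  have -> : q z - q 0 = (q z - q (toC r)) + (q (toC r) - q 0) by ring.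
  by apply: (le_trans (cabsD _ _)); rewrite lerD2l ltW.
have F2 : cabs (z - toC r) <= cabs z + e1.
  by apply: (le_trans (cabsB _ _)); rewrite lerD2l cr; lra.
have F3 : cabs (1 - Num.conj (q (toC r)) * q z) <= cabs (1 - Num.conj (q 0) * q z) + e1.
  have -> : 1 - Num.conj (q (toC r)) * q z =
     (1 - Num.conj (q 0) * q z) - Num.conj (q (toC r) - q 0) * q z.
    by rewrite rmorphB; ring.
  apply: (le_trans (cabsB _ _)); rewrite lerD2l cabsM cabs_conj.
  by have := cabs_ge0 (q z); have := cabs_ge0 (q (toC r) - q 0); nra.
have F4 : cabs (1 - Num.conj (q 0) * q z) <= 2.
  apply: (le_trans (cabsB _ _)); rewrite cabs1 cabsM cabs_conj.
  by have := cabs_ge0 (q 0); have := cabs_ge0 (q z); nra.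
have F5 : cabs (q z - q (toC r)) <= 2 by apply: (le_trans (cabsB _ _)); lra.
have Y0 := cabs_ge0 (1 - Num.conj (q (toC r)) * q z).
have Z0 := cabs_ge0 (z - toC r).
have h2 := le_trans h (ler_pM Z0 Y0 F2 F3).
have A0 := cabs_ge0 z; have B0 := cabs_ge0 (1 - Num.conj (q 0) * q z).
move: h2 F1 F4 F5 X1; move: (cabs (q z - q (toC r))) (cabs (q z - q 0)).
move: (cabs z) A0 z1 (cabs (1 - _)) B0 => A A0 A1 B B0 X X' h2 F1 F4 F5 X1.
have rX : r * X <= e1 by nra.
have : (A + e1) * (B + e1) <= A * B + 4 * e1.
  have -> : (A + e1) * (B + e1) = A * B + e1 * (A + B + e1) by ring.
  by rewrite lerD2l mulrC; apply: ler_wpM2r; lra.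
by lra.
Qed.

End SchwarzPick.

(** * The Schwarz lemma, its equality cases, and a Taylor estimate *)

Section Schwarz.
Variable R : realType.
Local Notation C := (Cx R).
Implicit Types (f g q : C -> C) (a b c u z w : C).

Lemma cabs_one_sub_conj a z : cabs a = 1 -> cabs (1 - Num.conj a * z) = cabs (z - a).
Proof.
move=> a1; have E : Num.conj a * a = 1 by rewrite mulrC mul_conj a1 expr1n.
have -> : 1 - Num.conj a * z = - (Num.conj a * (z - a)) by rewrite mulrBr E opprB.
by rewrite cabsN cabsM cabs_conj a1 mul1r.
Qed.

Lemma contraction_eq0 (t x : R) : t < 1 -> 0 <= x -> x <= t * x -> x = 0.
Proof.
move=> t1 x0 h; apply/eqP; rewrite eq_le x0 andbT leNgt; apply/negP => xp.
by move: h; rewrite -[leLHS]mul1r ler_pM2r // leNgt t1.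
Qed.

(** When one of the two values has modulus 1, both sides of [pick_except0] contain the same factor
    |q z - q 0|, and |z| < 1 forces it to vanish. This is used at [a] first; then |q 0| = 1 and it
    applies at every z. *)
Lemma in_disc_except_rigid q a : in_disc_except q ->
  (forall z, cabs z < 1 -> cabs (q z) <= 1) -> cabs a < 1 -> cabs (q a) = 1 ->
  forall z, cabs z < 1 -> q z = q a.
Proof.
move=> qe q1 a1 qa1.
have q0a : q a = q 0.
  have := pick_except0 qe q1 a1.
  have -> : cabs (1 - Num.conj (q 0) * q a) = cabs (q a - q 0).
    have -> : 1 - Num.conj (q 0) * q a = Num.conj (q a - q 0) * q a.
      by rewrite rmorphB mulrBl [Num.conj (q a) * _]mulrC mul_conj qa1 expr1n.
    by rewrite cabsM cabs_conj qa1 mulr1.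
  move=> /(contraction_eq0 a1 (cabs_ge0 _))/eqP.
  by rewrite cabs_eq0 subr_eq0 => /eqP.
move=> z z1; have := pick_except0 qe q1 z1.
rewrite cabs_one_sub_conj -?q0a // => /(contraction_eq0 z1 (cabs_ge0 _))/eqP.
by rewrite cabs_eq0 subr_eq0 => /eqP.
Qed.

(** The bound is not strict, because slopes and pointwise limits must be handled before they are
    known to stay inside the open disc; [disc_self_map] is the strict version. *)
Definition disc_map f : Prop := (forall z, cabs z < 1 -> differentiable f z) /\
  (forall z, cabs z < 1 -> cabs (f z) <= 1).

Lemma disc_map_except f : disc_map f -> in_disc_except f.
Proof.
move=> [fd _]; split; last by move=> z z1 _; exact: fd.
by apply: differentiable_continuous; apply: fd; rewrite cabs0.
Qed.

Lemma disc_map_max f : disc_map f -> cabs (f 0) = 1 ->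
  forall z, cabs z < 1 -> f z = f 0.
Proof.
move=> fm f01; apply: (in_disc_except_rigid (disc_map_except fm) fm.2) => //.
by rewrite cabs0.
Qed.

Definition slope0 f := slope f 0 (derive1 f 0).

Lemma slope00 f : slope0 f 0 = derive1 f 0.
Proof. by rewrite /slope0 /slope eqxx. Qed.

Lemma slope0E f z : f 0 = 0 -> f z = slope0 f z * z.
Proof.
move=> f0; have [->|z0] := eqVneq z 0; first by rewrite mulr0.
by rewrite /slope0 slope_neq // f0 !subr0 divfK.
Qed.

Lemma slope0_except f : disc_map f -> in_disc_except (slope0 f).
Proof.
move=> [fd _]; split.
  apply: slope_continuous; apply: differentiable_cder; apply: fd.
  by rewrite cabs0.
by move=> z z1 z0; apply: slope_differentiable => //; exact: fd.
Qed.

(** Both exceptional points of the maximum principle are 0 here. The value at 0 itself, which is the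
    derivative, is then bounded by continuity of the slope. *)
Lemma slope0_le1 f z : disc_map f -> f 0 = 0 -> cabs z < 1 -> cabs (slope0 f z) <= 1.
Proof.
move=> fm f0.
have [qc qd] := slope0_except fm.
have z01 : cabs (0 : C) < 1 by rewrite cabs0.
have H w : cabs w < 1 -> w != 0 -> cabs (slope0 f w) <= 1.
  move=> w1 w0; apply/ler_addgt0Pr => e e0.
  have e1 : 0 < 1 + e by lra.
  have rho1 : 0 <= (1 + e)^-1 < 1.
    by rewrite invr_ge0 (ltW e1) invf_lt1 // ltrDl.
  have qd' x : cabs x < 1 -> x != 0 -> x != 0 -> differentiable (slope0 f) x.
    by move=> x1 x0 _; exact: qd.
  apply: (maximum_principle_except z01 z01 qc qc qd' rho1 _ _ w1 w0 w0); last exact: ltW.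
  move=> x /andP[rx x1].
  have x0 : x != 0 by rewrite -cabs_gt0; apply: lt_le_trans rx; rewrite invr_gt0.
  have x0' : 0 < cabs x by rewrite cabs_gt0.
  rewrite /slope0 slope_neq // f0 !subr0 cabsM cabsV ler_pdivrMr //.
  apply: (le_trans (fm.2 _ x1)).
  by rewrite mulrC -ler_pdivrMr // mul1r.
move=> z1; have [->|] := eqVneq z 0; last exact: H.
apply/ler_addgt0Pr => e e0; have [d d0 Hd] := continuous_ccont qc e0.
pose r : R := Num.min d 1 / 2.
have r0 : 0 < r by rewrite divr_gt0 // lt_min d0 ltr01.
have r1 : r <= 1 / 2 by rewrite ler_wpM2r // ge_min lexx orbT.
have rd : r <= d / 2 by rewrite ler_wpM2r // ge_min lexx.
have cr : cabs (toC r) = r by rewrite cabs_real gtr0_norm.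
have := Hd (toC r); rewrite subr0 cr => /(_ ltac:(lra)) h.
have := H (toC r); rewrite cr -cabs_gt0 cr => /(_ ltac:(lra) r0) h2.
have -> : slope0 f 0 = slope0 f (toC r) - (slope0 f (toC r) - slope0 f 0) by ring.
by apply: (le_trans (cabsB _ _)); apply: lerD => //; exact: ltW.
Qed.

Lemma schwarz f z : disc_map f -> f 0 = 0 -> cabs z < 1 -> cabs (f z) <= cabs z.
Proof.
move=> fm f0 z1; rewrite (slope0E z f0) cabsM -[leRHS]mul1r.
by apply: ler_wpM2r; [exact: cabs_ge0|exact: slope0_le1].
Qed.

Lemma schwarz_derive f : disc_map f -> f 0 = 0 -> cabs (derive1 f 0) <= 1.
Proof. by move=> fm f0; rewrite -slope00; apply: slope0_le1 => //; rewrite cabs0. Qed.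

(** One statement serves both equality cases: [a] nonzero for values, a = 0 for the derivative. *)
Lemma schwarz_rigid_slope f a : disc_map f -> f 0 = 0 -> cabs a < 1 ->
  cabs (slope0 f a) = 1 ->
  exists2 u, cabs u = 1 & forall z, cabs z < 1 -> f z = u * z.
Proof.
move=> fm f0 a1 qa; exists (slope0 f a) => // z z1.
rewrite (slope0E z f0); congr (_ * _).
by apply: (in_disc_except_rigid (slope0_except fm)) => // w w1; exact: slope0_le1.
Qed.

Lemma schwarz_rigid f a : disc_map f -> f 0 = 0 -> cabs a < 1 -> a != 0 ->
  cabs (f a) = cabs a -> exists2 u, cabs u = 1 & forall z, cabs z < 1 -> f z = u * z.
Proof.
move=> fm f0 a1 a0 fa; apply: (schwarz_rigid_slope fm f0 a1).
have ca : cabs a != 0 by rewrite cabs_eq0.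
apply: (mulIf ca).
by rewrite mul1r -cabsM -slope0E.
Qed.

Lemma schwarz_rigid_derive f : disc_map f -> f 0 = 0 -> cabs (derive1 f 0) = 1 ->
  exists2 u, cabs u = 1 & forall z, cabs z < 1 -> f z = u * z.
Proof.
move=> fm f0 f1; apply: (@schwarz_rigid_slope f 0) => //; first by rewrite cabs0.
by rewrite slope00.
Qed.

Lemma cder_comp f g z a b : cder g z b -> cder f (g z) a ->
  cder (fun w => f (g w)) z (a * b).
Proof.
move=> gd fd e e0; have a0 := cabs_ge0 a; have b0 := cabs_ge0 b.
have [d1 d10 H1] := fd (e / (2 * (cabs b + 1))) ltac:(apply: divr_gt0; lra).
pose e2 := Num.min 1 (e / (2 * (cabs a + 1))).
have e20 : 0 < e2 by rewrite lt_min ltr01; apply: divr_gt0; lra.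
have [d2 d20 H2] := gd e2 e20.
have e2a : cabs a * e2 <= e / 2.
  apply: (@le_trans _ _ ((cabs a + 1) * (e / (2 * (cabs a + 1))))).
    apply: ler_pM => //; [exact: ltW|lra|by rewrite ge_min lexx orbT].
  by rewrite le_eqVlt; apply/orP; left; apply/eqP; field; lra.
exists (Num.min d2 (d1 / (cabs b + 1))).
  by rewrite lt_min d20; apply: divr_gt0; lra.
move=> w; rewrite lt_min => /andP[wd2]; rewrite ltr_pdivlMr; last lra.
move=> wd1; have {}H2 := H2 w wd2.
have t0 := cabs_ge0 (w - z).
have B : cabs (g w - g z) <= (cabs b + 1) * cabs (w - z).
  have -> : g w - g z = (g w - g z - b * (w - z)) + b * (w - z) by ring.
  apply: (le_trans (cabsD _ _)); rewrite cabsM mulrDl mul1r addrC lerD2l.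
  apply: (le_trans H2); rewrite -[leRHS]mul1r; apply: ler_wpM2r => //.
  by rewrite ge_min lexx.
have {}H1 := H1 (g w) ltac:(by rewrite (le_lt_trans B) // mulrC).
have -> : f (g w) - f (g z) - a * b * (w - z) =
  (f (g w) - f (g z) - a * (g w - g z)) + a * (g w - g z - b * (w - z)) by ring.
apply: (le_trans (cabsD _ _)); rewrite [e in leRHS]splitr mulrDl.
apply: lerD.
  apply: (le_trans H1); apply: (@le_trans _ _ (e / (2 * (cabs b + 1)) * ((cabs b + 1) * cabs (w - z)))).
    by apply: ler_wpM2l => //; apply/ltW/divr_gt0; lra.
  by rewrite le_eqVlt; apply/orP; left; apply/eqP; field; lra.
by rewrite cabsM; apply: le_trans (ler_wpM2r t0 e2a); rewrite -mulrA; apply: ler_wpM2l.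
Qed.

Lemma derive1_comp_cx f g z : differentiable g z -> differentiable f (g z) ->
  derive1 (fun w => f (g w)) z = derive1 f (g z) * derive1 g z.
Proof.
move=> /differentiable_cder gd /differentiable_cder fd.
exact: (cder_differentiable (cder_comp gd fd)).2.
Qed.

(** Subtracting [f 0] at most doubles the bound and halving restores it: this normalizes [f] to
    vanish at 0 while changing derivatives and remainders only by the factor 2. *)
Definition half_diff f w : C := 2^-1 * (f w - f 0).

Lemma cabs_half : cabs (2^-1 : C) = 2^-1.
Proof.
have -> : (2^-1 : C) = toC 2^-1 by rewrite toCV /toC rmorph_nat.
by rewrite cabs_real gtr0_norm.
Qed.

Lemma half_diff_map f : disc_map f -> [/\ disc_map (half_diff f),
  half_diff f 0 = 0 & derive1 (half_diff f) 0 = 2^-1 * derive1 f 0].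
Proof.
move=> fm; have z01 : cabs (0 : C) < 1 by rewrite cabs0.
have g0 : half_diff f 0 = 0 by rewrite /half_diff subrr mulr0.
split; [|exact: g0|].
  split => w w1.
    by apply: (differentiableZ (2^-1)); apply: differentiable_sub_cst; exact: fm.1.
  rewrite cabsM cabs_half; have := cabsB (f w) (f 0).
  by have := fm.2 w w1; have := fm.2 0 z01; lra.
apply: (fun H => (@cder_differentiable R (half_diff f) 0 (2^-1 * derive1 f 0) H).2) => e e0.
have [d d0 H] := differentiable_cder (fm.1 0 z01) e0; exists d => // w wd.
have -> : half_diff f w - half_diff f 0 - 2^-1 * derive1 f 0 * (w - 0) =
  2^-1 * (f w - f 0 - derive1 f 0 * (w - 0)) by rewrite g0 /half_diff; ring.
rewrite cabsM cabs_half; have := H w wd.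
by have := cabs_ge0 (f w - f 0 - derive1 f 0 * (w - 0)); lra.
Qed.

Lemma derive_disc_le f : disc_map f -> cabs (derive1 f 0) <= 2.
Proof.
move=> /half_diff_map [gm g0 dg]; have := schwarz_derive gm g0.
by rewrite dg cabsM cabs_half; lra.
Qed.

(** With s the slope of [half_diff f], the remainder is 2 (s z - s 0) z, and [pick_except0] bounds
    |s z - s 0| by 2 |z|. *)
Lemma taylor_disc f z : disc_map f -> cabs z < 1 ->
  cabs (f z - f 0 - derive1 f 0 * z) <= 4 * cabs z ^+ 2.
Proof.
move=> fm z1; have z01 : cabs (0 : C) < 1 by rewrite cabs0.
have [gm g0 dg] := half_diff_map fm; set g := half_diff f in gm g0 dg.
have := pick_except0 (slope0_except gm) (fun w => @slope0_le1 g w gm g0) z1.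
have -> : f z - f 0 - derive1 f 0 * z = 2 * (slope0 g z - slope0 g 0) * z.
  rewrite slope00 mulrBr mulrBl -mulrA -(slope0E z g0) dg /g /half_diff.
  by field.
have cc2 : cabs (2 : C) = 2.
  by have := cabs_half; rewrite cabsV => /(congr1 (@GRing.inv _)); rewrite !invrK.
rewrite !cabsM cc2 => h.
have : cabs (1 - Num.conj (slope0 g 0) * slope0 g z) <= 2.
  apply: (le_trans (cabsB _ _)); rewrite cabs1 cabsM cabs_conj.
  have := slope0_le1 gm g0 z1; have := slope0_le1 gm g0 z01.
  by have := cabs_ge0 (slope0 g z); have := cabs_ge0 (slope0 g 0); nra.
have := cabs_ge0 (slope0 g z - slope0 g 0); have := cabs_ge0 z.
move: h; move: (cabs (1 - _)) (cabs (slope0 g z - _)) (cabs z) => x y t h t0 y0 x2.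
have : y <= 2 * t by nra.
by nra.
Qed.

End Schwarz.

(** * The Schwarz-Pick lemma, its equality cases, and monotonicity of artanh *)

Section Poincare.
Variable R : realType.
Local Notation C := (Cx R).
Implicit Types (f g s : C -> C) (a b c u v z w : C).

Lemma cder_factor f s z : {for z, continuous s} ->
  (exists2 d : R, 0 < d & forall w, cabs (w - z) < d -> f w - f z = s w * (w - z)) ->
  cder f z (s z).
Proof.
move=> /continuous_ccont sc [d d0 H] e e0; have [d1 d10 H1] := sc e e0.
exists (Num.min d d1); first by rewrite lt_min d0.
move=> w; rewrite lt_min => /andP[wd wd1]; rewrite H // -mulrBl cabsM.
by apply: ler_wpM2r; [exact: cabs_ge0|exact/ltW/H1].
Qed.

Lemma cder_moebius a z : cabs a < 1 -> cabs z < 1 ->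
  cder (moebius a) z (toC (1 - cabs a ^+ 2) / (1 - Num.conj a * z) ^+ 2).
Proof.
move=> a1 z1; have dz := moebius_den a1 (ltW z1).
(* [s w] is the exact difference quotient of [moebius a] between [z] and [w], extended continuously
   to w = z. *)
pose s w : C := (1 - Num.conj a * w)^-1 * (toC (1 - cabs a ^+ 2) * (1 - Num.conj a * z)^-1).
have sd : differentiable s z.
  apply: (@differentiableM _ _ (fun w => (1 - Num.conj a * w)^-1)
    (cst (toC (1 - cabs a ^+ 2) * (1 - Num.conj a * z)^-1)));
    last exact: differentiable_cst.
  apply: differentiableV; last exact: dz.
  apply: differentiableB; first exact: differentiable_cst.
  by apply: (@differentiableZ _ _ _ id); exact: differentiable_id.
have -> : toC (1 - cabs a ^+ 2) / (1 - Num.conj a * z) ^+ 2 = s z.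
  by rewrite /s; field.
apply: (cder_factor (differentiable_continuous sd)).
exists (1 - cabs z); first by rewrite subr_gt0.
move=> w wz; have w1 : cabs w < 1.
  by rewrite -(subrK z w); apply: (le_lt_trans (cabsD _ _)); lra.
have dw := moebius_den a1 (ltW w1).
by rewrite /moebius /s toCD toCN toC1 -mul_conj; field; rewrite dz dw.
Qed.

Lemma derive1_moebius_center a : cabs a < 1 ->
  derive1 (moebius a) a = toC (1 - cabs a ^+ 2)^-1.
Proof.
move=> a1; rewrite (cder_differentiable (cder_moebius a1 a1)).2.
have -> : 1 - Num.conj a * a = toC (1 - cabs a ^+ 2).
  by rewrite toCD toCN toC1 -mul_conj mulrC.
have n0 : toC (1 - cabs a ^+ 2) != 0.
  by rewrite -toC0 (inj_eq (@toC_inj R)); have := cabs_ge0 a => ?; apply/eqP; nra.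
by rewrite toCV expr2 invfM mulrA divff // mul1r.
Qed.

Lemma derive1_moebius0 a : cabs a < 1 ->
  derive1 (moebius a) 0 = toC (1 - cabs a ^+ 2).
Proof.
move=> a1; have z1 : cabs (0 : C) < 1 by rewrite cabs0.
rewrite (cder_differentiable (cder_moebius a1 z1)).2.
by rewrite mulr0 subr0 expr1n divr1.
Qed.

Definition disc_self_map f : Prop := (forall z, cabs z < 1 -> differentiable f z) /\
  (forall z, cabs z < 1 -> cabs (f z) < 1).

Lemma moebius_self_map a : cabs a < 1 -> disc_self_map (moebius a).
Proof.
by move=> a1; split => z z1; [exact: differentiable_moebius|exact: cabs_moebius_lt1].
Qed.

Lemma self_map_disc f : disc_self_map f -> disc_map f.
Proof. by move=> [fd f1]; split => // z z1; apply/ltW/f1. Qed.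

Lemma disc_map_comp f g : disc_map f -> disc_self_map g -> disc_map (fun z => f (g z)).
Proof.
move=> [fd f1] [gd g1]; split => z z1; last exact/f1/g1.
by apply: (@differentiable_comp _ _ _ _ g f); [exact: gd|exact/fd/g1].
Qed.

Lemma self_map_comp f g : disc_self_map f -> disc_self_map g ->
  disc_self_map (fun z => f (g z)).
Proof.
move=> [fd f1] [gd g1]; split => z z1; last exact/f1/g1.
by apply: (@differentiable_comp _ _ _ _ g f); [exact: gd|exact/fd/g1].
Qed.

Lemma schwarz_pick f z w : disc_self_map f -> cabs z < 1 -> cabs w < 1 ->
  cabs (moebius (f w) (f z)) <= cabs (moebius w z).
Proof.
move=> fm z1 w1; have Nw1 : cabs (- w) < 1 by rewrite cabsN.
have mfw := moebius_self_map (fm.2 w w1).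
have Fm := self_map_disc (self_map_comp mfw (self_map_comp fm (moebius_self_map Nw1))).
have := schwarz Fm _ (cabs_moebius_lt1 w1 z1).
by rewrite moebiusK // moebiusx0 opprK moebiusxx; apply.
Qed.

Lemma schwarz_pick_derive f w : disc_self_map f -> cabs w < 1 ->
  cabs (derive1 f w) * (1 - cabs w ^+ 2) <= 1 - cabs (f w) ^+ 2.
Proof.
move=> fm w1; have Nw1 : cabs (- w) < 1 by rewrite cabsN.
have z1 : cabs (0 : C) < 1 by rewrite cabs0.
have mw := moebius_self_map Nw1; have mfw := moebius_self_map (fm.2 w w1).
have w0 : moebius (- w) 0 = w by rewrite moebiusx0 opprK.
have Fm := self_map_comp mfw (self_map_comp fm mw).
have := schwarz_derive (self_map_disc Fm); rewrite w0 moebiusxx => /(_ erefl).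
have d1 := mw.1 0 z1.
have d2 : differentiable f (moebius (- w) 0) by rewrite w0; exact: fm.1.
have d3 : differentiable (moebius (f w)) (f (moebius (- w) 0)) 
  by rewrite w0; exact/mfw.1/fm.2.
have d23 := (self_map_comp fm mw).1 0 z1.
rewrite (derive1_comp_cx d23 d3) (derive1_comp_cx d1 d2) w0 derive1_moebius0 //.
rewrite derive1_moebius_center ?fm.2 // !cabsM !cabs_real cabsN.
have fw := fm.2 w w1; have := cabs_ge0 (f w); have := cabs_ge0 w => w00 fw0.
rewrite gtr0_norm; last by rewrite invr_gt0; nra.
rewrite gtr0_norm; last by nra.
by rewrite mulrC ler_pdivrMr ?mul1r //; nra.
Qed.

Lemma pick_rigid f w z : disc_map f -> cabs w < 1 -> cabs z < 1 -> z != w ->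
  f w = 0 -> cabs (f z) = cabs (moebius w z) ->
  exists2 u, cabs u = 1 & forall z, cabs z < 1 -> f z = u * moebius w z.
Proof.
move=> fm w1 z1 zw fw E; have Nw1 : cabs (- w) < 1 by rewrite cabsN.
have Fm := disc_map_comp fm (moebius_self_map Nw1).
have F0 : f (moebius (- w) 0) = 0 by rewrite moebiusx0 opprK.
have m1 := cabs_moebius_lt1 w1 z1.
have m0 : moebius w z != 0 by rewrite moebius_eq0 // ltW.
have [|u u1 H] := schwarz_rigid Fm F0 m1 m0; first by rewrite moebiusK.
exists u => // x x1; have := H _ (cabs_moebius_lt1 w1 x1).
by rewrite moebiusK.
Qed.

Lemma pick_rigid_derive f w : disc_map f -> cabs w < 1 -> f w = 0 ->
  cabs (derive1 f w) * (1 - cabs w ^+ 2) = 1 ->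
  exists2 u, cabs u = 1 & forall z, cabs z < 1 -> f z = u * moebius w z.
Proof.
move=> fm w1 fw E; have Nw1 : cabs (- w) < 1 by rewrite cabsN.
have z1 : cabs (0 : C) < 1 by rewrite cabs0.
have mw := moebius_self_map Nw1.
have Fm := disc_map_comp fm mw.
have w0 : moebius (- w) 0 = w by rewrite moebiusx0 opprK.
have F0 : f (moebius (- w) 0) = 0 by rewrite w0.
have [|u u1 H] := schwarz_rigid_derive Fm F0.
  have d2 : differentiable f (moebius (- w) 0) by rewrite w0; exact: fm.1.
  rewrite (derive1_comp_cx (mw.1 0 z1) d2).
  rewrite w0 derive1_moebius0 // cabsM cabs_real cabsN gtr0_norm //.
  by have := cabs_ge0 w; nra.
exists u => // x x1; have := H _ (cabs_moebius_lt1 w1 x1).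
by rewrite moebiusK.
Qed.

Lemma artanh_lt (s t : R) : -1 < s < 1 -> -1 < t < 1 ->
  (artanh s < artanh t) = (s < t).
Proof.
move=> /andP[s0 s1] /andP[t0 t1]; rewrite /artanh ltr_pM2r ?invr_gt0 //.
rewrite ltr_ln ?posrE; try by apply: divr_gt0; lra.
rewrite ltr_pdivrMr; last lra.
rewrite mulrAC ltr_pdivlMr; last lra.
by apply/idP/idP => h; nra.
Qed.

Lemma artanh_le (s t : R) : -1 < s < 1 -> -1 < t < 1 ->
  (artanh s <= artanh t) = (s <= t).
Proof. by move=> s1 t1; rewrite !leNgt artanh_lt. Qed.

Lemma cabs_itv z : cabs z < 1 -> -1 < cabs z < 1.
Proof. by move=> ->; rewrite andbT; have := cabs_ge0 z; lra. Qed.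

Lemma poincare_distE z w : poincare_dist z w = artanh (cabs (moebius w z)).
Proof. by []. Qed.

End Poincare.

(** * Limits of bounded complex sequences along an ultrafilter *)

Section UltraLimit.
Variable R : realType.
Local Notation C := (Cx R).
Variable U : set_system nat.
Hypothesis UU : UltraFilter U.

Let UP : ProperFilter U := @ultra_proper _ _ UU.

(** The limit is the supremum of the reals that lie below [u k] for [U]-almost all k. Above the
    supremum, the ultrafilter alternative is needed: failing to be in [U] puts the complement in
    [U]. *)
Lemma ultra_real_limit (u : nat -> R) (B : R) : (forall k, `|u k| <= B) ->
  exists l : R, forall e, 0 < e -> U [set k | `|u k - l| < e].
Proof.
move=> uB; pose S := [set x : R | U [set k | x <= u k]].
have S0 : S (- B).
  rewrite /S /=; apply: (filterS (P := setT)); last exact: filterT.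
  by move=> k _ /=; have := uB k; rewrite ler_norml => /andP[].
have SB x : S x -> x <= B.
  move=> /filter_ex [k /= h]; apply: (le_trans h).
  by have := uB k; rewrite ler_norml => /andP[].
have hS : has_sup S by split; [exists (- B)|exists B => x; exact: SB].
exists (sup S) => e e0.
have [x Sx xl] := sup_adherent e0 hS.
have U2 : U [set k | u k < sup S + e].
  have [//|h] := in_ultra_setVsetC [set k | u k < sup S + e] UU.
  have : S (sup S + e).
    by apply: (filterS _ h) => k /= /negP; rewrite -leNgt.
  by move=> /(ub_le_sup hS.2); rewrite gerDl leNgt e0.
apply: (filterS _ (filterI Sx U2)) => k /= [h1 h2].
by rewrite ltr_norml; apply/andP; split; lra.
Qed.

Definition ulim (u : nat -> C) (l : C) : Prop :=
  forall e : R, 0 < e -> U [set k | cabs (u k - l) < e].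

Lemma ulim_exists (u : nat -> C) (B : R) : (forall k, cabs (u k) <= B) ->
  exists l, ulim u l.
Proof.
move=> uB.
have [a Ha] := @ultra_real_limit (fun k => complex.Re (u k)) B
  (fun k => le_trans (Re_le_cabs _) (uB k)).
have [b Hb] := @ultra_real_limit (fun k => complex.Im (u k)) B
  (fun k => le_trans (Im_le_cabs _) (uB k)).
exists (Complex a b) => e e0; have e2 : 0 < e / 2 by lra.
apply: (filterS _ (filterI (Ha _ e2) (Hb _ e2))) => k /= [h1 h2].
apply: (le_lt_trans (cabs_le_ReIm _)); rewrite ReB ImB /=; lra.
Qed.

Lemma ulim_cst c : ulim (fun=> c) c.
Proof.
move=> e e0; apply: (filterS (P := setT)); last exact: filterT.
by move=> k _ /=; rewrite subrr cabs0.
Qed.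

Lemma ulimD u v a b : ulim u a -> ulim v b -> ulim (fun k => u k + v k) (a + b).
Proof.
move=> ua vb e e0; have e2 : 0 < e / 2 by lra.
apply: (filterS _ (filterI (ua _ e2) (vb _ e2))) => k /= [h1 h2].
have -> : u k + v k - (a + b) = (u k - a) + (v k - b) by ring.
by apply: (le_lt_trans (cabsD _ _)); lra.
Qed.

Lemma ulimZ c u a : ulim u a -> ulim (fun k => c * u k) (c * a).
Proof.
move=> ua e e0; have c0 := cabs_ge0 c.
have /ua h : 0 < e / (cabs c + 1) by apply: divr_gt0; lra.
apply: (filterS _ h) => k /=; rewrite ltr_pdivlMr; last lra.
by rewrite -mulrBr cabsM; have := cabs_ge0 (u k - a); nra.
Qed.

Lemma ulimB u v a b : ulim u a -> ulim v b -> ulim (fun k => u k - v k) (a - b).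
Proof.
move=> ua /(ulimZ (-1)) vb; have := ulimD ua vb; rewrite mulN1r.
by rewrite [X in ulim X _](_ : _ = fun k => u k - v k) //; apply/funext => k; rewrite mulN1r.
Qed.

Lemma ulim_le u a (B : R) : ulim u a -> U [set k | cabs (u k) <= B] -> cabs a <= B.
Proof.
move=> ua uB; apply/ler_addgt0Pr => e e0.
have [k [/= h1 h2]] := filter_ex (filterI (ua e e0) uB).
have -> : a = u k - (u k - a) by ring.
by apply: (le_trans (cabsB _ _)); lra.
Qed.

Lemma ulim_ge u a (B : R) : ulim u a -> U [set k | B <= cabs (u k)] -> B <= cabs a.
Proof.
move=> ua uB; apply/ler_addgt0Pr => e e0.
have [k [/= h1 h2]] := filter_ex (filterI (ua e e0) uB).
by have := cabs_distD (u k) a; lra.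
Qed.

Lemma ulim_unique u a b : ulim u a -> ulim u b -> a = b.
Proof.
move=> ua ub; apply/eqP; rewrite -subr_eq0 -cabs_eq0 eq_le cabs_ge0 andbT.
apply: (ulim_le (ulimB ua ub)); apply: (filterS (P := setT)); last exact: filterT.
by move=> k _ /=; rewrite subrr cabs0.
Qed.

End UltraLimit.

(** * Pointwise limits of bounded holomorphic functions *)

Section Montel.
Variable R : realType.
Local Notation C := (Cx R).
Variable V : normedModType C.
Implicit Types (x y t : V) (g : V -> C) (D : set V).

Lemma cder_line g x t s0 : differentiable g (s0 *: t + x) ->
  cder (fun s : C => g (s *: t + x)) s0 ('d g (s0 *: t + x) t).
Proof.
move=> gd e e0; have t0 := rnorm_ge0 t.
have e1 : 0 < e / (rnorm t + 1) by apply: divr_gt0; lra.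
have [d d0 H] := differentiable_approx gd e1.
exists (d / (rnorm t + 1)); first by apply: divr_gt0; lra.
move=> s; rewrite ltr_pdivlMr; last lra.
move=> sd; have s0' := cabs_ge0 (s - s0).
have st : rnorm ((s - s0) *: t) = cabs (s - s0) * rnorm t by rewrite rnormZ.
have := H ((s - s0) *: t); rewrite st => /(_ ltac:(nra)).
rewrite addrA -scalerDl subrK linearZ rnorm_cabs => h.
rewrite [_ * (s - s0)]mulrC; apply: (le_trans h).
have -> : e / (rnorm t + 1) * (cabs (s - s0) * rnorm t) =
  e * cabs (s - s0) * (rnorm t / (rnorm t + 1)) by field; lra.
have : rnorm t / (rnorm t + 1) <= 1 by rewrite ler_pdivrMr; lra.
by move=> h2; rewrite -[leRHS]mulr1; apply: ler_wpM2l => //; apply: mulr_ge0 => //; exact: ltW.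
Qed.

Definition ball_in D x (r : R) := forall y, rnorm (y - x) < r -> D y.

Lemma open_ball_in D x : open D -> D x -> exists2 r : R, 0 < r & ball_in D x r.
Proof.
move=> oD Dx; have /near_rnormP[r r0 H] : nbhs x D by exact: open_nbhs_nbhs.
by exists r.
Qed.

Lemma line_disc_map D g x t (r : R) : ball_in D x r -> rnorm t <= r -> 0 < r ->
  holo_on D g -> (forall z, D z -> cabs (g z) <= 1) ->
  disc_map (fun s : C => g (s *: t + x)) /\
  derive1 (fun s : C => g (s *: t + x)) 0 = 'd g x t.
Proof.
move=> Br tr r0 gh g1.
have Ds (s : C) : cabs s < 1 -> D (s *: t + x).
  move=> s1; apply: Br; rewrite addrK rnormZ.
  by have := rnorm_ge0 t; have := cabs_ge0 s; nra.
have cd (s : C) : cabs s < 1 -> cder (fun s : C => g (s *: t + x)) s ('d g (s *: t + x) t).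
  by move=> s1; apply: cder_line; apply: gh; exact: Ds.
split; first split.
- by move=> s s1; exact: (cder_differentiable (cd s s1)).1.
- by move=> s s1; exact/g1/Ds.
have z1 : cabs (0 : C) < 1 by rewrite cabs0.
by have := (cder_differentiable (cd 0 z1)).2; rewrite scale0r add0r.
Qed.

(** Every t is s t' with |t'| <= r and |s| = |t| / r, so the bounds of one variable apply to the
    slice in the direction t'. The constants depend on r alone and not on [g], which lets both
    bounds pass to the limit. *)
Lemma taylor_ball D g x (r : R) : ball_in D x r -> 0 < r ->
  holo_on D g -> (forall z, D z -> cabs (g z) <= 1) ->
  (forall t, cabs ('d g x t) <= 2 / r * rnorm t) /\
  (forall t, rnorm t < r -> cabs (g (t + x) - g x - 'd g x t) <= 4 * (rnorm t / r) ^+ 2).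
Proof.
move=> Br r0 gh g1.
have key t : exists s t', [/\ t = s *: t', rnorm t' <= r & cabs s = rnorm t / r].
  have [->|t0] := eqVneq t 0.
    by exists 0, 0; rewrite scale0r rnorm0 cabs0 mul0r; split => //; exact: ltW.
  have nt0 : rnorm t != 0 by rewrite rnorm_eq0.
  have nt : 0 < rnorm t by rewrite lt_def nt0 rnorm_ge0.
  have s0 : toC (rnorm t / r) != 0.
    by rewrite -cabs_gt0 cabs_real gtr0_norm divr_gt0.
  exists (toC (rnorm t / r)), ((toC (rnorm t / r))^-1 *: t); split => //.
  - by rewrite scalerA divff // scale1r.
  - rewrite rnormZ cabsV cabs_real gtr0_norm ?divr_gt0 // invf_div.
    by rewrite divfK.
  - by rewrite cabs_real gtr0_norm // divr_gt0.
have lin (s : C) t' : 'd g x (s *: t') = s * 'd g x t' by rewrite linearZ.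
split=> t; have [s [t' [tE t'r cs]]] := key t.
  have [fm fd] := line_disc_map Br t'r r0 gh g1.
  have := derive_disc_le fm; rewrite fd => h.
  rewrite tE lin cabsM cs -tE mulrC -mulrA [r^-1 * _]mulrC.
  by apply: ler_wpM2r => //; rewrite divr_ge0 // ?rnorm_ge0 // ltW.
move=> tr; have [fm fd] := line_disc_map Br t'r r0 gh g1.
have s1 : cabs s < 1 by rewrite cs ltr_pdivrMr // mul1r.
have := taylor_disc fm s1; rewrite fd scale0r add0r -tE -cs.
by rewrite {3}tE lin mulrC.
Qed.

Section Limit.
Variables (D : set V) (g_ : nat -> V -> C) (U : set_system nat).
Hypotheses (UU : UltraFilter U) (oD : open D).
Hypothesis gh : forall k, holo_on D (g_ k).
Hypothesis g1 : forall k z, D z -> cabs (g_ k z) <= 1.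

Let UP : ProperFilter U := @ultra_proper _ _ UU.

(** The ultrafilter limit of the differentials is linear and bounded, and the uniform quadratic
    remainder, passed to the limit, identifies it as the differential of the limit function. *)
Lemma montel : exists G : V -> C, [/\ holo_on D G,
  (forall z, D z -> ulim U (fun k => g_ k z) (G z)) &
  (forall z t, D z -> ulim U (fun k => 'd (g_ k) z t) ('d G z t))].
Proof.
have /choice [G HG] : forall z, exists l, D z -> ulim U (fun k => g_ k z) l.
  move=> z; have [Dz|] := pselect (D z); last by exists 0.
  have [l Hl] := ulim_exists UU (fun k => g1 k Dz).
  by exists l.
suff H z : D z -> differentiable G z /\
     (forall t, ulim U (fun k => 'd (g_ k) z t) ('d G z t)).
  exists G; split; [|exact: HG|].
  - by move=> z /H [h _]; exact: h.
  - by move=> z t /H [_ h]; exact: h.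
move=> Dz; have [r r0 Br] := open_ball_in oD Dz.
have T k := taylor_ball Br r0 (gh k) (g1 k).
have /choice [L HL] : forall t, exists l, ulim U (fun k => 'd (g_ k) z t) l.
  by move=> t; apply: (ulim_exists UU) => k; exact: (T k).1.
have linL : linear L.
  move=> a u v; apply: (ulim_unique UU (HL _)).
  have -> : (fun k => 'd (g_ k) z (a *: u + v)) =
     (fun k => a * 'd (g_ k) z u + 'd (g_ k) z v).
    by apply/funext => k; rewrite linearP.
  exact: (ulimD UU (ulimZ UU a (HL u)) (HL v)).
have LM t : rnorm (L t) <= 2 / r * rnorm t.
  rewrite rnorm_cabs; apply: (ulim_le UU (HL t)).
  by apply: (filterS (P := setT)); [move=> k _ /=; exact: (T k).1|exact: filterT].
have LA : linear_approx G z L.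
  (* Below e r^2 / 4, the quadratic remainder 4 (|t| / r)^2 is at most e |t|. *)
  move=> e e0; exists (Num.min r (e * r ^+ 2 / 4)).
    by rewrite lt_min r0 /= divr_gt0 // mulr_gt0 // exprn_gt0.
  move=> t; rewrite lt_min => /andP[tr te].
  have Dt : D (t + z) by apply: Br; rewrite addrK.
  rewrite rnorm_cabs.
  have h : cabs (G (t + z) - G z - L t) <= 4 * (rnorm t / r) ^+ 2.
    apply: (ulim_le UU (ulimB UU (ulimB UU (HG _ Dt) (HG _ Dz)) (HL t))).
    by apply: (filterS (P := setT)); [move=> k _ /=; exact: (T k).2|exact: filterT].
  apply: (le_trans h).
  have -> : 4 * (rnorm t / r) ^+ 2 = (4 / r ^+ 2 * rnorm t) * rnorm t by field; lra.
  apply: ler_wpM2r; first exact: rnorm_ge0.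
  have r2 : 0 < r ^+ 2 by rewrite exprn_gt0.
  move: te; rewrite ltr_pdivlMr // => te.
  by rewrite mulrAC ler_pdivrMr //; lra.
have [dG dE] := approx_differentiable linL LM LA.
split; first exact: dG.
by move=> t; exact: (eq_ind_r (fun f : V -> C => ulim U _ (f t)) (HL t) dE).
Qed.

End Limit.

(** The points with |G| < 1 and those with |G| = 1 both form open sets: by [disc_map_max], G is
    constant on the disc slices centred at a point of modulus 1. *)
Lemma strict_bound_connected D (G : V -> C) x0 : open D -> connected D ->
  holo_on D G -> (forall z, D z -> cabs (G z) <= 1) -> D x0 -> cabs (G x0) < 1 ->
  forall z, D z -> cabs (G z) < 1.
Proof.
move=> oD cD Gh G1 Dx0 Gx0.
pose B := [set z | D z /\ cabs (G z) < 1].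
pose A := [set z | D z /\ cabs (G z) = 1].
have oB : open B.
  rewrite openE => z [Dz Gz]; apply/near_rnormP.
  have [r r0 Br] := open_ball_in oD Dz.
  have e0 : 0 < 1 - cabs (G z) by rewrite subr_gt0.
  have [d d0 Hd] := continuous_rnorm (differentiable_continuous (Gh z Dz)) e0.
  exists (Num.min r d); first by rewrite lt_min r0.
  move=> y; rewrite lt_min => /andP[yr yd]; split; first exact: Br.
  have := Hd y yd; rewrite rnorm_cabs => h.
  by have := cabs_distD (G y) (G z); lra.
have oA : open A.
  rewrite openE => z [Dz Gz]; apply/near_rnormP.
  have [r r0 Br] := open_ball_in oD Dz.
  exists (r / 2); first lra.
  move=> y yr; split; first by apply: Br; lra.
  (* The direction is doubled so that [y] sits at the parameter 1/2, strictly inside the slice. *)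
  have tr : rnorm (2 *: (y - z)) <= r.
    rewrite rnormZ; have -> : cabs (2 : C) = 2.
      by have -> : (2 : C) = toC 2; [rewrite /toC rmorph_nat|rewrite cabs_real ger0_norm].
    by lra.
  have [fm _] := line_disc_map Br tr r0 Gh G1.
  have := disc_map_max fm; rewrite scale0r add0r => /(_ Gz (2^-1)).
  rewrite cabs_half scalerA mulVf ?scale1r ?subrK; last by rewrite pnatr_eq0.
  by move=> -> //; lra.
have E : B = D.
  apply: cD.
  - by exists x0.
  - by exists B => //; apply/seteqP; split => z; [move=> [? ?]; split|move=> []].
  - exists (~` A); first by rewrite closedC.
    apply/seteqP; split => z.
      by move=> [Dz Gz]; split => // -[_ Gz1]; move: Gz; rewrite Gz1 ltxx.
    move=> [Dz nA]; split => //; rewrite lt_neqAle G1 // andbT.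
    by apply/eqP => Gz1; apply: nA.
by move=> z; rewrite -{1}E => -[].
Qed.

End Montel.

Lemma le_mx_norm_coord (K : numDomainType) m n (M : 'M[K]_(m, n)) i j :
  `|M i j| <= `|M|.
Proof.
have := lexx (mx_norm M); rewrite mx_normE num_le => /bigmax_leP[_ /(_ (i, j) isT)].
by rewrite -num_le.
Qed.

(** * Holomorphic lifting through the parametrization of V *)

Section Inverse.
Variable R : realType.
Local Notation C := (Cx R).

Lemma derive1_curve (V : normedModType C) (g : V -> C) (h : C -> V) z :
  differentiable h z -> differentiable g (h z) ->
  derive1 (g \o h) z = 'd g (h z) (derive1 h z).
Proof.
move=> hd gd; rewrite derive1E (deriveE _ (differentiable_comp hd gd)).
rewrite derive1E (deriveE _ hd).
exact: (congr1 (fun f : C -> C => f 1) (diff_comp hd gd)).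
Qed.

Lemma rnorm_coord n (M : 'rV[C]_n) j : cabs (M ord0 j) <= rnorm M.
Proof.
rewrite -toC_le -cabsE -rnormE; exact: le_mx_norm_coord.
Qed.

(** Implicit differentiation of k (G y) = r y. Continuity of [G] at x brings the increment of [G]
    into the range of the expansion of [k]; this first gives a Lipschitz bound at x, then the
    differential [c^-1 * L]. *)
Lemma approx_inverse (V : normedModType C) (k : C -> C) (r G L : V -> C) (x : V)
    (c : C) (M : R) :
  cder k (G x) c -> c != 0 -> linear L -> (forall t, rnorm (L t) <= M * rnorm t) ->
  linear_approx r x L ->
  (forall e : R, 0 < e -> exists2 d : R, 0 < d &
    forall t, rnorm t < d -> k (G (t + x)) = r (t + x) /\ cabs (G (t + x) - G x) < e) ->
  differentiable G x.
Proof.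
move=> kd c0 linL LM LA GC.
have cc : 0 < cabs c by rewrite cabs_gt0.
pose N : R := Num.max M 0.
have N0 : 0 <= N by rewrite le_max lexx orbT.
have LN t : cabs (L t) <= N * rnorm t.
  rewrite -rnorm_cabs; apply: (le_trans (LM t)); apply: ler_wpM2r; first exact: rnorm_ge0.
  by rewrite le_max lexx.
(* [K] is the Lipschitz constant: with e1 <= |c| / 2, the term e1 |w| is absorbed in |c| |w|, which
   leaves |c| |w| / 2 <= (N + 1) |t|. *)
pose K : R := 2 / cabs c * (N + 1).
have K0 : 0 < K by rewrite /K mulr_gt0 ?divr_gt0 //; lra.
have linL' : linear (fun t => c^-1 * L t).
  by move=> a u v; rewrite linL mulrDr [_ *: L u]/(_ * L u) mulrCA.
have LM' t : rnorm (c^-1 * L t) <= ((cabs c)^-1 * N) * rnorm t.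
  rewrite rnorm_cabs cabsM cabsV -mulrA; apply: ler_wpM2l; last exact: LN.
  by rewrite invr_ge0 ltW.
apply: (approx_differentiable linL' LM' _).1 => e e0.
pose e1 := Num.min (cabs c / 2) (e * cabs c / (2 * K)).
have e10 : 0 < e1.
  rewrite lt_min; apply/andP; split; first lra.
  by apply: divr_gt0; [exact: mulr_gt0|lra].
have e1c : e1 <= cabs c / 2 by rewrite ge_min lexx.
have e1K : e1 * K <= e * cabs c / 2.
  apply: (@le_trans _ _ (e * cabs c / (2 * K) * K)).
    by apply: ler_wpM2r; [exact: ltW|rewrite ge_min lexx orbT].
  by rewrite le_eqVlt; apply/orP; left; apply/eqP; field; lra.
pose e2 := Num.min 1 (e * cabs c / 2).
have e20 : 0 < e2 by rewrite lt_min ltr01 /= divr_gt0 // mulr_gt0.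
have e21 : e2 <= 1 by rewrite ge_min lexx.
have e2c : e2 <= e * cabs c / 2 by rewrite ge_min lexx orbT.
have [d1 d10 H1] := kd e1 e10.
have [d2 d20 H2] := LA e2 e20.
have [d3 d30 H3] := GC d1 d10.
exists (Num.min d2 d3); first by rewrite lt_min d20.
move=> t; rewrite lt_min => /andP[td2 td3].
have [kE Gd] := H3 t td3.
have zero : rnorm (0 : V) < d3 by rewrite rnorm0.
have [kE0 _] := H3 0 zero; rewrite add0r in kE0.
have {}H1 := H1 _ Gd; have {}H2 := H2 t td2; rewrite rnorm_cabs in H2.
rewrite kE kE0 in H1; rewrite rnorm_cabs.
have t0 := rnorm_ge0 t.
set w := G (t + x) - G x in H1 Gd *.
set y := r (t + x) - r x in H1 H2.
have A : cabs c * cabs w <= N * rnorm t + e2 * rnorm t + e1 * cabs w.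
  rewrite -cabsM.
  have -> : c * w = L t + (y - L t) - (y - c * w) by ring.
  apply: (le_trans (cabsB _ _)); apply: lerD => //.
  by apply: (le_trans (cabsD _ _)); apply: lerD.
have w0 := cabs_ge0 w.
have B : cabs w <= K * rnorm t.
  have : cabs c / 2 * cabs w <= (N + 1) * rnorm t by nra.
  move=> h; rewrite -(@ler_pM2l _ (cabs c / 2)); last lra.
  apply: (le_trans h); rewrite le_eqVlt; apply/orP; left; apply/eqP.
  by rewrite /K; field; lra.
rewrite -(@ler_pM2l _ (cabs c)) // -cabsM.
have -> : c * (w - c^-1 * L t) = (y - L t) - (y - c * w).
  by rewrite mulrBr mulrA divff // mul1r; ring.
apply: (le_trans (cabsB _ _)).
apply: (@le_trans _ _ (e2 * rnorm t + e1 * (K * rnorm t))).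
  by apply: lerD => //; apply: (le_trans H1); apply: ler_wpM2l => //; exact: ltW.
have -> : e2 * rnorm t + e1 * (K * rnorm t) = (e2 + e1 * K) * rnorm t by ring.
by rewrite [leRHS]mulrA; apply: ler_wpM2r => //; lra.
Qed.

Lemma row_neq0 n (v : 'rV[C]_n) : v != 0 -> exists j, v ord0 j != 0.
Proof.
move=> v0; apply: contrapT => /forallNP H; move/eqP: v0; apply.
apply/rowP => j; rewrite mxE; apply/eqP; apply: contrapT => /negP; exact: H.
Qed.

Lemma open_of_balls (V : normedModType C) (A : set V) :
  (forall x, A x -> exists2 r : R, 0 < r & ball_in A x r) -> open A.
Proof. by move=> H; rewrite openE => x /H h; exact/near_rnormP. Qed.

Lemma open_cabs_ball a (r : R) : open [set z : C | cabs (z - a) < r].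
Proof.
apply: open_of_balls => z /= zr; exists (r - cabs (z - a)); first by rewrite subr_gt0.
move=> y; rewrite rnorm_cabs /= => hy.
have -> : y - a = (y - z) + (z - a) by ring.
by apply: (le_lt_trans (cabsD _ _)); lra.
Qed.

Lemma open_unit_disc : open (unit_disc R).
Proof.
by have := @open_cabs_ball 0 1; under eq_set do rewrite subr0.
Qed.

(** Near each point a coordinate of [h] with nonzero derivative makes [approx_inverse] applicable.
    The source [W] is general, since the lemma serves both retractions of D and geodesics defined on
    the disc. *)
Lemma lift_to_disc n (D V : set 'rV[C]_n) (h : C -> 'rV[C]_n)
    (W : normedModType C) (E : set W) (rho : W -> 'rV[C]_n) :
  disc_submanifold D V h -> open E -> holo_on E rho -> (forall y, E y -> V (rho y)) ->
  exists G : W -> C, [/\ holo_on E G, (forall y, E y -> unit_disc R (G y)) &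
    (forall y, E y -> h (G y) = rho y)].
Proof.
move=> [hh [VE [_ [_ [hinj [h'0 hopen]]]]]] oE rh rV.
have /choice [G HG] : forall y, exists z, E y -> unit_disc R z /\ h z = rho y.
  move=> y; have [Ey|] := pselect (E y); last by exists 0.
  by have := rV y Ey; rewrite VE => -[z z1 hz]; exists z.
have G1 y : E y -> unit_disc R (G y) by move=> /HG[].
have G2 y : E y -> h (G y) = rho y by move=> /HG[].
exists G; split; [|exact: G1|exact: G2].
move=> x Ex; have [j hj] := row_neq0 (h'0 _ (G1 x Ex)).
have [M M0 HM] := diff_bounded (rh x Ex).
pose L t := ('d rho x t) ord0 j.
have linL : linear L by move=> a u v; rewrite /L linearP !mxE.
have LM t : rnorm (L t) <= M * rnorm t.
  rewrite rnorm_cabs; exact: (le_trans (rnorm_coord _ _) (HM t)).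
have LA : linear_approx (fun y => rho y ord0 j) x L.
  move=> e e0; have [d d0 Hd] := differentiable_approx (rh x Ex) e0.
  exists d => // t td; apply: le_trans (Hd t td); rewrite rnorm_cabs.
  by apply: le_trans (rnorm_coord _ j); rewrite !mxE.
have kd : cder (fun z => h z ord0 j) (G x) ((derive1 h (G x)) ord0 j).
  have hd := hh _ (G1 x Ex).
  move=> e e0; have [d d0 Hd] := differentiable_approx hd e0.
  exists d => // w wd; have := Hd (w - G x); rewrite rnorm_cabs => /(_ wd).
  rewrite subrK; apply: le_trans; apply: le_trans (rnorm_coord _ j).
  by rewrite (diff1E hd) !mxE mulrC.
apply: (approx_inverse kd hj linL LM LA) => e e0.
have [r r0 Br] := open_ball_in oE Ex.
(* Continuity of the lift: [h] carries [U] onto the trace on V of an open [N], so as soon as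
   [rho (t + x)] lies in [N], injectivity places [G (t + x)] in [U]. *)
pose U := [set z : C | cabs (z - G x) < e].
have oU : open U by exact: open_cabs_ball.
have [N [oN NE]] := hopen U oU.
have Nx : N (rho x).
  suff : (N `&` V) (rho x) by case.
  rewrite -NE; exists (G x); last exact: G2.
  by split; [rewrite /U /= subrr cabs0|exact: G1].
have [s s0 Bs] := open_ball_in oN Nx.
have [d d0 Hd] := continuous_rnorm (differentiable_continuous (rh x Ex)) s0.
exists (Num.min r d); first by rewrite lt_min r0.
move=> t; rewrite lt_min => /andP[tr td].
have Et : E (t + x) by apply: Br; rewrite addrK.
split; first by rewrite G2.
have : (N `&` V) (rho (t + x)).
  by split; [apply: Bs; apply: Hd; rewrite addrK|exact: rV].
rewrite -NE => -[u [Uu u1] hu].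
suff -> : G (t + x) = u by exact: Uu.
by apply: hinj; rewrite ?inE; [exact: G1|exact: u1|rewrite G2].
Qed.

End Inverse.

(** * Carathéodory distances and metrics of D and V, and left inverses of h *)

Section Caratheodory.
Variables (R : realType) (n : nat) (D V : set 'rV[Cx R]_n) (h : Cx R -> 'rV[Cx R]_n).
Local Notation C := (Cx R).
Hypotheses (HD : bounded_domain D) (HS : disc_submanifold D V h).
Implicit Types (x y v : 'rV[C]_n) (a b z w : C) (g : 'rV[C]_n -> C).

Let oD : open D. Proof. by case: HD => _ []. Qed.

Let cD : connected D. Proof. by case: HD => _ [_ []]. Qed.

Let hh z : cabs z < 1 -> differentiable h z.
Proof. by case: HS => H _; exact: H. Qed.

Let VE : V = h @` unit_disc R. Proof. by case: HS => _ []. Qed.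

Let VD x : V x -> D x. Proof. by case: HS => _ [_ [H _]]; exact: H. Qed.

Let Vh z : cabs z < 1 -> V (h z).
Proof. by move=> z1; rewrite VE; exists z. Qed.

Let Dh z : cabs z < 1 -> D (h z).
Proof. by move=> /Vh/VD. Qed.

Let Vex x : V x -> exists2 z, cabs z < 1 & h z = x.
Proof. by rewrite VE. Qed.

Let hinj a b : cabs a < 1 -> cabs b < 1 -> h a = h b -> a = b.
Proof.
case: HS => _ [_ [_ [_ [H _]]]] a1 b1 E.
by apply: H; rewrite ?inE; [exact: a1|exact: b1|exact: E].
Qed.

Let h'0 z : cabs z < 1 -> derive1 h z != 0.
Proof. by case: HS => _ [_ [_ [_ [_ [H _]]]]] z1; exact: H. Qed.

Lemma holo_sub_self_map g : holo_sub_to_disc V h g -> disc_self_map (g \o h).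
Proof. by move=> [gd g1]; split => z z1; [exact: gd|exact/g1/Vh]. Qed.

Lemma holo_restrict g : holo_to_disc D g -> holo_sub_to_disc V h g.
Proof.
move=> [gd g1]; split=> [z z1|z /VD Dz]; last exact: g1.
exact: (differentiable_comp (hh z1) (gd _ (Dh z1))).
Qed.

(** The inverse of [h] is extremal for both the distance and the metric of V. *)
Lemma chart_exists : exists g, holo_sub_to_disc V h g /\
  forall z, cabs z < 1 -> g (h z) = z /\ derive1 (g \o h) z = 1.
Proof.
have /choice [g Hg] : forall y, exists z, V y -> cabs z < 1 /\ h z = y.
  move=> y; have [/Vex[z z1 hz]|] := pselect (V y); last by exists 0.
  by exists z.
have gK z : cabs z < 1 -> g (h z) = z.
  by move=> z1; have [g1 gh] := Hg _ (Vh z1); exact: hinj.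
have gc z : cabs z < 1 -> cder (g \o h) z 1.
  move=> z1 e e0; exists (1 - cabs z); first by rewrite subr_gt0.
  move=> w wz; have w1 : cabs w < 1 by have := cabs_distD w z; lra.
  rewrite /= !gK // mul1r subrr cabs0.
  by apply: mulr_ge0; [exact: ltW|exact: cabs_ge0].
exists g; split; last by move=> z z1; split; [exact: gK|exact: (cder_differentiable (gc z z1)).2].
split => z z1; first exact: (cder_differentiable (gc z z1)).1.
by have [] := Hg z z1.
Qed.

Lemma cara_dist_le x y : (cara_dist D x y <= cara_dist_sub V h x y)%E.
Proof.
by apply: ereal_sup_le => _ [g gD <-]; exists g => //; exact: holo_restrict.
Qed.

Lemma cara_dist_subE a b : cabs a < 1 -> cabs b < 1 ->
  cara_dist_sub V h (h a) (h b) = (poincare_dist a b)%:E.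
Proof.
move=> a1 b1; apply/eqP; rewrite eq_le; apply/andP; split.
  apply: ge_ereal_sup => _ [g gV <-]; rewrite lee_fin !poincare_distE.
  have gm := holo_sub_self_map gV.
  rewrite artanh_le; first exact: (schwarz_pick gm a1 b1).
  - by apply: cabs_itv; apply: cabs_moebius_lt1; [exact: (gm.2 b b1)|exact: (gm.2 a a1)].
  - by apply: cabs_itv; exact: cabs_moebius_lt1.
have [g [gV gK]] := chart_exists.
apply: ereal_sup_ubound; exists g => //.
by rewrite (gK a a1).1 (gK b b1).1.
Qed.

Lemma poincare_metric_le a (l : C) g : holo_sub_to_disc V h g -> cabs a < 1 ->
  poincare_metric (g (h a)) (l * derive1 (g \o h) a) <= poincare_metric a l.
Proof.
move=> gV a1; have gm := holo_sub_self_map gV.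
have := schwarz_pick_derive gm a1; rewrite /poincare_metric cabsM.
have := gm.2 a a1; rewrite /=; set c0 := derive1 _ _; set ga := g (h a) => ga1 H.
have ga0 := cabs_ge0 ga; have a0 := cabs_ge0 a; have l0 := cabs_ge0 l.
have p1 : 0 < 1 - cabs ga ^+ 2 by nra.
have p2 : 0 < 1 - cabs a ^+ 2 by nra.
rewrite ler_pdivrMr // mulrAC ler_pdivlMr // -mulrA.
exact: ler_wpM2l.
Qed.

Lemma tangent_coord a (l m : C) : cabs a < 1 ->
  l *: derive1 h a = m *: derive1 h a -> l = m.
Proof.
move=> a1 /eqP; rewrite -subr_eq0 -scalerBl scaler_eq0 (negbTE (h'0 a1)) orbF.
by rewrite subr_eq0 => /eqP.
Qed.

Lemma cara_metric_subE a (l : C) : cabs a < 1 ->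
  cara_metric_sub V h (h a) (l *: derive1 h a) = (poincare_metric a l)%:E.
Proof.
move=> a1; apply/eqP; rewrite eq_le; apply/andP; split.
  apply: ge_ereal_sup => _ [g [z [m [gV z1 hz vE ->]]]]; rewrite lee_fin.
  have za : z = a by exact: hinj.
  rewrite za in vE *; rewrite -(tangent_coord a1 vE).
  exact: poincare_metric_le.
have [g [gV gK]] := chart_exists.
apply: ereal_sup_ubound; exists g, a, l; split => //.
by rewrite (gK a a1).1 (gK a a1).2 mulr1.
Qed.

Lemma derive_tangent g a (l : C) : holo_to_disc D g -> cabs a < 1 ->
  'D_(l *: derive1 h a) g (h a) = l * derive1 (g \o h) a.
Proof.
move=> [gd _] a1; have ga := gd _ (Dh a1).
by rewrite (deriveE _ ga) linearZ (derive1_curve (hh a1) ga).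
Qed.

Lemma cara_metric_le a (l : C) : cabs a < 1 ->
  (cara_metric D (h a) (l *: derive1 h a) <= (poincare_metric a l)%:E)%E.
Proof.
move=> a1; apply: ge_ereal_sup => _ [g gD <-]; rewrite lee_fin derive_tangent //.
exact: (poincare_metric_le _ (holo_restrict gD) a1).
Qed.

Definition has_left_inverse := exists G, holo_to_disc D G /\
  forall z, cabs z < 1 -> G (h z) = z.

Lemma left_inverse_retraction : has_left_inverse -> exists rho, holo_retraction D V rho.
Proof.
move=> [G [[Gd G1] GK]]; exists (h \o G); split.
- by move=> z Dz; exact: (differentiable_comp (Gd z Dz) (hh (G1 z Dz))).
- by move=> z Dz; exact/Dh/G1.
- by move=> z Dz /=; rewrite GK //; exact: G1.
- apply/seteqP; split => [_ [z Dz <-]|x /Vex[z z1 <-]]; first exact/Vh/G1.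
  by exists (h z); [exact: Dh|rewrite /= GK].
Qed.

Lemma retraction_left_inverse rho : holo_retraction D V rho -> has_left_inverse.
Proof.
move=> [rd rD rr rV].
have rV' y : D y -> V (rho y) by move=> Dy; rewrite -rV; exists y.
have [G [Gd G1 GE]] := lift_to_disc HS oD rd rV'.
exists G; split; first by split.
move=> z z1; apply: hinj => //; first exact/G1/Dh.
rewrite GE; last exact: Dh.
by have := Vh z1; rewrite -rV => -[y Dy <-]; exact: rr.
Qed.

Lemma left_inverse_dist a b : has_left_inverse -> cabs a < 1 -> cabs b < 1 ->
  cara_dist D (h a) (h b) = (poincare_dist a b)%:E.
Proof.
move=> [G [GD GK]] a1 b1; apply/eqP; rewrite eq_le; apply/andP; split.
  by rewrite -cara_dist_subE //; exact: cara_dist_le.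
by apply: ereal_sup_ubound; exists G => //; rewrite !GK.
Qed.

Lemma left_inverse_metric a (l : C) : has_left_inverse -> cabs a < 1 ->
  cara_metric D (h a) (l *: derive1 h a) = (poincare_metric a l)%:E.
Proof.
move=> [G [GD GK]] a1; apply/eqP; rewrite eq_le; apply/andP; split.
  exact: cara_metric_le.
apply: ereal_sup_ubound; exists G => //; rewrite derive_tangent // GK //.
suff -> : derive1 (G \o h) a = 1 by rewrite mulr1.
apply: (fun H => (@cder_differentiable R (G \o h) a 1 H).2) => e e0.
exists (1 - cabs a); first by rewrite subr_gt0.
move=> w wa; have w1 : cabs w < 1 by have := cabs_distD w a; lra.
rewrite /= !GK // mul1r subrr cabs0.
by apply: mulr_ge0; [exact: ltW|exact: cabs_ge0].
Qed.

Lemma rigid_left_inverse g w (u : C) : holo_to_disc D g -> cabs w < 1 -> cabs u = 1 ->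
  (forall z, cabs z < 1 -> g (h z) = u * moebius w z) -> has_left_inverse.
Proof.
move=> [gd g1] w1 u1 gE; have Nw1 : cabs (- w) < 1 by rewrite cabsN.
have u0 : u != 0 by rewrite -cabs_gt0 u1.
have k1 y : D y -> cabs (u^-1 * g y) < 1.
  by move=> Dz; rewrite cabsM cabsV u1 invr1 mul1r; exact: g1.
exists (fun y => moebius (- w) (u^-1 * g y)); split; last first.
  by move=> z z1; rewrite gE // mulKf // moebiusK.
split => y Dy; last exact: cabs_moebius_lt1 Nw1 (k1 y Dy).
apply: (@differentiable_comp _ _ _ _ (fun y => u^-1 * g y) (moebius (- w))).
  exact: (differentiableZ u^-1 (gd y Dy)).
exact: (differentiable_moebius Nw1 (k1 y Dy)).
Qed.

Lemma moebius_holo g c : holo_to_disc D g -> cabs c < 1 ->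
  holo_to_disc D (fun y => moebius c (g y)).
Proof.
move=> [gd g1] c1; split => z Dz; last exact: cabs_moebius_lt1 c1 (g1 z Dz).
apply: (@differentiable_comp _ _ _ _ g (moebius c)); first exact: (gd z Dz).
exact: (differentiable_moebius c1 (g1 z Dz)).
Qed.

(** The ultrafilter refines the eventuality filter, so the defects 1 / (k + 1) disappear in the
    limit. The common zero [x0] is what [strict_bound_connected] needs to keep the limit in the open
    disc. *)
Lemma extremal_limit (g_ : nat -> 'rV[C]_n -> C) x0 :
  (forall k, holo_to_disc D (g_ k)) -> D x0 -> (forall k, g_ k x0 = 0) ->
  exists G, [/\ holo_to_disc D G, G x0 = 0,
    (forall y (m : R), D y -> (forall k, m - k.+1%:R^-1 <= cabs (g_ k y)) ->
        m <= cabs (G y)) &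
    (forall y t (m : R), D y -> (forall k, m - k.+1%:R^-1 <= cabs ('d (g_ k) y t)) ->
        m <= cabs ('d G y t))].
Proof.
move=> gD Dx0 g0.
have [U [UU Uoo]] := ultraFilterLemma eventually_filter.
have gd k : holo_on D (g_ k) by case: (gD k).
have g1 k y : D y -> cabs (g_ k y) <= 1 by move=> Dy; apply: ltW; exact: (gD k).2.
have [G [Gd Gl Gdl]] := montel UU oD gd g1.
have UP : ProperFilter U := @ultra_proper _ _ UU.
have all_ (P : set nat) : (forall k, P k) -> U P.
  by move=> H; apply: (filterS (P := setT)); [move=> k _; exact: H|exact: filterT].
have G1 y : D y -> cabs (G y) <= 1.
  by move=> Dy; apply: (ulim_le UU (Gl y Dy)); apply: all_ => k; exact: g1.
have G0 : G x0 = 0.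
  apply: (ulim_unique UU (Gl x0 Dx0)).
  have -> : (fun k => g_ k x0) = (fun=> 0) by apply/funext.
  exact: ulim_cst.
have low (s : nat -> C) (l : C) (m : R) : ulim U s l ->
    (forall k, m - k.+1%:R^-1 <= cabs (s k)) -> m <= cabs l.
  move=> sl ms; apply/ler_addgt0Pr => e e0.
  rewrite -lerBlDr; apply: (ulim_ge UU sl); apply: Uoo.
  have [N _ HN] := near_infty_natSinv_lt (PosNum e0).
  exists N => // k Nk /=; apply: le_trans (ms k).
  by rewrite lerD2l lerN2; exact: ltW (HN k Nk).
exists G; split; [|exact: G0| |].
- split; first exact: Gd.
  apply: (strict_bound_connected oD cD Gd G1 Dx0).
  by rewrite G0 cabs0.
- by move=> y m Dy; exact: low (Gl y Dy).
- by move=> y t m Dy; exact: low (Gdl y t Dy).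
Qed.

Lemma holo_self_map g : holo_to_disc D g -> disc_self_map (g \o h).
Proof. by move=> /holo_restrict/holo_sub_self_map. Qed.

Lemma dist_left_inverse a b : cabs a < 1 -> cabs b < 1 -> a != b ->
  cara_dist D (h a) (h b) = (poincare_dist a b)%:E -> has_left_inverse.
Proof.
move=> a1 b1 ab E; pose r := cabs (moebius b a).
have r1 : r < 1 by exact: cabs_moebius_lt1.
have r0 : 0 < r by rewrite cabs_gt0 moebius_eq0 // ltW.
have /choice [g_ Hg] : forall k, exists g,
    [/\ holo_to_disc D g, g (h b) = 0 & r - k.+1%:R^-1 <= cabs (g (h a))].
  move=> k; have k0 : 0 < k.+1%:R^-1 :> R by rewrite invr_gt0 ltr0n.
  have k1 : k.+1%:R^-1 <= 1 :> R by rewrite invf_le1 ?ltr0n // ler1n.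
  (* The lowered radius may be negative, but it stays in the interval where [artanh] is strictly
     increasing. *)
  have rk : -1 < r - k.+1%:R^-1 < 1.
    move: r r0 r1 (k.+1%:R^-1) k0 k1 => r r0 r1 c k0 k1.
    by apply/andP; split; lra.
  have : ((artanh (r - k.+1%:R^-1))%:E < cara_dist D (h a) (h b))%E.
    rewrite E lte_fin poincare_distE artanh_lt -/r; first by rewrite gtrBl.
      exact: rk.
    exact: cabs_itv.
  move=> /ereal_sup_gt [_ [g gD <-]]; rewrite lte_fin poincare_distE.
  have ga1 := gD.2 _ (Dh a1); have gb1 := gD.2 _ (Dh b1).
  rewrite artanh_lt; first last.
  - by apply: cabs_itv; exact: cabs_moebius_lt1.
  - exact: rk.
  move=> h1; exists (fun y => moebius (g (h b)) (g y)); split.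
  - exact: moebius_holo.
  - exact: moebiusxx.
  - exact: ltW.
have [|||G [GD G0 Ga _]] := @extremal_limit g_ (h b).
- by move=> k; have [] := Hg k.
- exact: Dh.
- by move=> k; have [] := Hg k.
have fm := holo_self_map GD.
have fa : cabs ((G \o h) a) = cabs (moebius b a).
  apply/eqP; rewrite eq_le; apply/andP; split.
    by have := schwarz_pick fm a1 b1; rewrite /= G0 moebius0x.
  by apply: Ga; [exact: Dh|move=> k; have [] := Hg k].
have [u u1 Hu] := pick_rigid (self_map_disc fm) b1 a1 ab G0 fa.
exact: (rigid_left_inverse GD b1 u1 Hu).
Qed.

Lemma metric_left_inverse a (l : C) : cabs a < 1 -> l != 0 ->
  cara_metric D (h a) (l *: derive1 h a) = (poincare_metric a l)%:E -> has_left_inverse.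
Proof.
move=> a1 l0 E; have a0 := cabs_ge0 a.
have p0 : 0 < 1 - cabs a ^+ 2 by nra.
have l0' : 0 < cabs l by rewrite cabs_gt0.
(* [m] is the Poincaré length at [a] of the unit vector: the Schwarz-Pick bound for the derivative
   of [g \o h] at [a] when [g (h a)] is 0. *)
pose m := (1 - cabs a ^+ 2)^-1.
have /choice [g_ Hg] : forall k, exists g,
    [/\ holo_to_disc D g, g (h a) = 0 & m - k.+1%:R^-1 <= cabs (derive1 (g \o h) a)].
  move=> k; have k0 : 0 < k.+1%:R^-1 :> R by rewrite invr_gt0 ltr0n.
  have : ((cabs l * (m - k.+1%:R^-1))%:E < cara_metric D (h a) (l *: derive1 h a))%E.
    by rewrite E lte_fin /poincare_metric ltr_pM2l // -/m gtrBl.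
  move=> /ereal_sup_gt [_ [g gD <-]]; rewrite lte_fin derive_tangent //.
  have gm := holo_self_map gD.
  have ga1 : cabs (g (h a)) < 1 by exact: gD.2 _ (Dh a1).
  rewrite /poincare_metric cabsM -mulrA ltr_pM2l // => h1.
  exists (fun y => moebius (g (h a)) (g y)); split.
  - exact: moebius_holo.
  - exact: moebiusxx.
  (* Moving [g (h a)] to 0 multiplies the derivative by 1 / (1 - |g (h a)|^2), which turns its
     Poincaré length into a plain modulus. *)
  have := derive1_comp_cx (gm.1 a a1) (differentiable_moebius ga1 (gm.2 a a1)).
  rewrite derive1_moebius_center // => E2.
  have -> : derive1 ((fun y => moebius (g (h a)) (g y)) \o h) a =
     toC (1 - cabs (g (h a)) ^+ 2)^-1 * derive1 (g \o h) a by exact: E2.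
  have q0 : 0 < 1 - cabs (g (h a)) ^+ 2 by have := cabs_ge0 (g (h a)); nra.
  rewrite cabsM cabs_real gtr0_norm ?invr_gt0 // mulrC; exact: ltW.
have [|||G [GD G0 _ Gd]] := @extremal_limit g_ (h a).
- by move=> k; have [] := Hg k.
- exact: Dh.
- by move=> k; have [] := Hg k.
have fm := holo_self_map GD.
have chain g : holo_to_disc D g -> derive1 (g \o h) a = 'd g (h a) (derive1 h a).
  by move=> [gd _]; exact: (derive1_curve (hh a1) (gd _ (Dh a1))).
have fa : cabs (derive1 (G \o h) a) * (1 - cabs a ^+ 2) = 1.
  apply/eqP; rewrite eq_le; apply/andP; split.
    have := schwarz_pick_derive fm a1; rewrite /= G0 cabs0 expr0n subr0; exact.
  rewrite -ler_pdivrMr // mul1r -/m chain //; apply: Gd; first exact: Dh.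
  by move=> k; have [gD _ H] := Hg k; rewrite -chain.
have [u u1 Hu] := pick_rigid_derive (self_map_disc fm) a1 G0 fa.
exact: (rigid_left_inverse GD a1 u1 Hu).
Qed.

Lemma left_inverse_geodesic : has_left_inverse ->
  exists phi, complex_geodesic D phi /\ phi @` unit_disc R = V.
Proof.
move=> H; exists h; split; last by rewrite VE.
split; [exact: hh|exact: Dh|].
by move=> z w z1 w1; exact: left_inverse_dist.
Qed.

(** The geodesic may parametrize V differently from [h]. The transition map [psi], with h (psi z) =
    phi z, is a self-map of the disc, so by Schwarz-Pick the distance in V is at most the Poincaré
    distance of the parameters, which is the distance in D. *)
Lemma geodesic_dist phi : complex_geodesic D phi -> phi @` unit_disc R = V ->
  forall x y, V x -> V y -> cara_dist D x y = cara_dist_sub V h x y.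
Proof.
move=> [pd pD pE] pV x y Vx Vy; apply/eqP; rewrite eq_le cara_dist_le /=.
have pV' z : unit_disc R z -> V (phi z) by move=> z1; rewrite -pV; exists z.
have [psi [sd s1 sE]] := lift_to_disc HS (@open_unit_disc R) pd pV'.
move: Vx Vy; rewrite -{1 2}pV => -[z z1 <-] [w w1 <-].
rewrite pE // -!sE // cara_dist_subE; [|exact: s1|exact: s1].
have sm : disc_self_map psi by split; [exact: sd|exact: s1].
rewrite lee_fin !poincare_distE artanh_le; first exact: schwarz_pick.
- by apply: cabs_itv; apply: cabs_moebius_lt1; exact: s1.
- by apply: cabs_itv; exact: cabs_moebius_lt1.
Qed.

Lemma dist_distinct_points :
  (forall x y, V x -> V y -> cara_dist D x y = cara_dist_sub V h x y) ->
  exists x y, [/\ V x, V y, x != y & cara_dist D x y = cara_dist_sub V h x y].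
Proof.
have z1 : cabs (0 : C) < 1 by rewrite cabs0.
have w1 : cabs (2^-1 : C) < 1 by rewrite cabs_half; lra.
move=> H; exists (h 0), (h 2^-1); split; [exact: Vh|exact: Vh| |].
  apply/eqP => /(hinj z1 w1) /eqP; rewrite eq_sym invr_eq0.
  by rewrite pnatr_eq0.
by apply: H; exact: Vh.
Qed.

Lemma dist_eq_left_inverse x y : V x -> V y -> x != y ->
  cara_dist D x y = cara_dist_sub V h x y -> has_left_inverse.
Proof.
move=> /Vex[a a1 <-] /Vex[b b1 <-] ab; rewrite cara_dist_subE //.
by apply: dist_left_inverse => //; apply/eqP => E; move/eqP: ab; rewrite E.
Qed.

Lemma left_inverse_metric_eq x v : has_left_inverse -> tangent_sub h x v ->
  cara_metric D x v = cara_metric_sub V h x v.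
Proof.
move=> LI [a [l [a1 <- ->]]].
by rewrite left_inverse_metric // cara_metric_subE.
Qed.

Lemma metric_nonzero_vector :
  (forall x v, V x -> tangent_sub h x v -> cara_metric D x v = cara_metric_sub V h x v) ->
  exists x v, [/\ V x, tangent_sub h x v, v != 0 &
    cara_metric D x v = cara_metric_sub V h x v].
Proof.
have z1 : cabs (0 : C) < 1 by rewrite cabs0.
move=> H; exists (h 0), (derive1 h 0).
have tg : tangent_sub h (h 0) (derive1 h 0) by exists 0, 1; rewrite scale1r.
by split; [exact: Vh|exact: tg|exact: h'0|apply: H; [exact: Vh|exact: tg]].
Qed.

Lemma metric_eq_left_inverse x v : tangent_sub h x v -> v != 0 ->
  cara_metric D x v = cara_metric_sub V h x v -> has_left_inverse.
Proof.
move=> [a [l [a1 <- ->]]] v0; rewrite cara_metric_subE //.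
by apply: metric_left_inverse => //; apply/eqP => l0; move/eqP: v0; rewrite l0 scale0r.
Qed.

End Caratheodory.

Theorem theorem14p2 (R : realType) (n : nat) (D V : set 'rV[Cx R]_n)
  (h : Cx R -> 'rV[Cx R]_n) :
  bounded_domain D -> disc_submanifold D V h ->
  [<-> (exists rho, holo_retraction D V rho);
       (exists phi, complex_geodesic D phi /\ phi @` unit_disc R = V);
       (forall x y, V x -> V y -> cara_dist D x y = cara_dist_sub V h x y);
       (exists x y, [/\ V x, V y, x != y & cara_dist D x y = cara_dist_sub V h x y]);
       (forall x v, V x -> tangent_sub h x v ->
          cara_metric D x v = cara_metric_sub V h x v);
       (exists x v, [/\ V x, tangent_sub h x v, v != 0 &
          cara_metric D x v = cara_metric_sub V h x v])].
Proof.
(* The goals are the six implications of the cycle. Those out of (i), (iv) and (vi) construct the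
   left inverse of [h]; (ii) to (iii) is [geodesic_dist], and the other two only exhibit a pair of
   points or a tangent vector. *)
move=> HD HS; split; last split; last split; last split; last split.
- by move=> [rho /(retraction_left_inverse HD HS)/(left_inverse_geodesic HS)].
- by move=> [phi [pg pV]]; exact: (geodesic_dist HS pg pV).
- exact: dist_distinct_points HS.
- move=> [x [y [Vx Vy xy E]]] x' v _.
  exact: (left_inverse_metric_eq HS (dist_eq_left_inverse HD HS Vx Vy xy E)).
- exact: metric_nonzero_vector HS.
- move=> [x [v [_ tg v0 E]]].
  exact: (left_inverse_retraction HS (metric_eq_left_inverse HD HS tg v0 E)).
Qed.
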